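(* Let $X$ be a compact manifold, and let $H^\infty_E=C^\infty(X)$ and $G^\infty_F$ be as in the context. (i) The delta mapping $\delta:X\to\widehat{H^\infty_E}$ defined by $\delta(x)=\delta_x$, where $$\delta_x(\phi)=\langle\delta_x,\phi\rangle_{H^\infty_E}=\sum_{j=1}^\infty\sum_{l=1}^{d_j}\widehat\phi(j,l)(\delta_x)_{jl}=\phi(x)\quad\text{for all }\phi\in H^\infty_E,\ x\in X,$$ is an $H^\infty_E$-mapping. (ii) If $\tilde g:\widehat{H^\infty_E}\to G^\infty_F$ is a sequential linear mapping, then the composed mapping $\tilde g\circ\delta:X\to G^\infty_F$ is an $H^\infty_E$-mapping. (iii) For any $H^\infty_E$-mapping $f:X\to G^\infty_F$ there exists a unique sequential linear mapping $\widehat f:\widehat{H^\infty_E}\to G^\infty_F$ such that $f=\widehat f\circ\delta$.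
   Context: Let $X$ be a compact $C^\infty$ manifold without boundary with a fixed measure (a smooth positive density), and let $\mathcal{H}=L^2(X)$. Let $\{e_{jl}: j\in\mathbb{N},\ 1\le l\le d_j\}$ ($d_j\in\mathbb{N}$ positive integers, $\mathbb{N}=\{1,2,\dots\}$) be an orthonormal basis of $\mathcal{H}$ and $0<\lambda_1\le\lambda_2\le\cdots$ a sequence with $\sum_j d_j\lambda_j^{-s_0}<\infty$ for some $s_0>0$; let $E$ be the positive self-adjoint operator $E\phi=\sum_j\sum_l\lambda_j(\phi,e_{jl})_{\mathcal{H}}e_{jl}$. Put $\widehat\phi(j,l)=(\phi,e_{jl})_{\mathcal{H}}$ and $$H^\infty_E=\Big\{\phi\in\mathcal{H}:\ \sum_{j=1}^\infty\lambda_j^{2s}\sum_{l=1}^{d_j}|\widehat\phi(j,l)|^2<\infty\ \text{for all }s\in\mathbb{R}\Big\}.$$ It is assumed that $H^\infty_E=C^\infty(X)$ (as is the case e.g. when $E$ is a positive elliptic pseudo-differential operator of positive order and the $e_{jl}$ are its eigenfunctions with eigenvalues $\lambda_j$), elements being identified with their smooth representatives. $H^\infty_E$ is also identified with the sequence space of coefficients $(\widehat\phi(j,l))_{j,l}$. Let $\mathcal{G}$ be a separable complex Hilbert space with orthonormal basis $\{h_{ki}:k\in\mathbb{N},1\le i\le g_k\}$ ($g_k\in\mathbb{N}$), let $0<\mu_1\le\mu_2\le\cdots$ satisfy $\sum_k g_k\mu_k^{-s_0'}<\infty$ for some $s_0'>0$, let $F$ be the operator associated with these data in the same way as $E$ above,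 and let $$G^\infty_F=\Big\{\psi\in\mathcal{G}:\ \sum_{k=1}^\infty\mu_k^{2s}\sum_{i=1}^{g_k}|(\psi,h_{ki})_{\mathcal{G}}|^2<\infty\ \text{for all }s\in\mathbb{R}\Big\},$$ identified with the sequence space of coefficients $((\psi,h_{ki})_{\mathcal{G}})_{k,i}$. (For instance $\mathcal{G}=L^2(Y)$, $G^\infty_F=C^\infty(Y)$ for a compact manifold $Y$.) A sequence space is a linear subspace $V$ of the space of all complex families on a fixed countable index set. Its $\alpha$-dual $\widehat V$ is the set of all families $a$ on the same index set with $\sum_\iota|v_\iota||a_\iota|<\infty$ for all $v\in V$; the pairing is the bilinear form given by the absolutely convergent sum $\langle v,a\rangle_V=\sum_\iota v_\iota a_\iota$ (also written $\langle a,v\rangle_V$). Each $a\in\widehat V$ is identified with the functional $v\mapsto\langle v,a\rangle_V$ on $V$. A mapping $\phi:V\to W$ between sequence spaces is a sequential linear mapping if it is linear and for every $g\in\widehat W$ the composition $g\circ\phi:V\to\mathbb{C}$ is (given by an element) in $\widehat V$. A mapping $f:X\to W$ from $X$ to a sequence space $W$ is called an $H^\infty_E$-mapping if for every $u\in\widehat W$ the composed mapping $u\circ f:X\to\mathbb{C}$ belongs to $H^\infty_E$. *)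

(* Defs.v *)
From HB Require Import structures.
From mathcomp Require Import all_boot all_order all_algebra.
From mathcomp Require Import complex.
From mathcomp Require Import all_classical all_reals all_analysis.

Set Implicit Arguments.
Unset Strict Implicit.
Unset Printing Implicit Defensive.

Import Order.TTheory GRing.Theory Num.Theory.
Import numFieldNormedType.Exports.
Import ComplexField.Normc.

Local Open Scope classical_set_scope.
Local Open Scope ring_scope.

Definition borel (T : ptopologicalType) := g_sigma_algebraType (@open T).

Section Smooth.
Context {R : realType}.

(* [U] is always open below, so ['D_v f x], which only depends on the germ of
   [f] at [x], is the partial derivative of the restriction of [f] to [U]. *)
Fixpoint Ck_on (k n : nat) (U : set 'rV[R]_n) (f : 'rV[R]_n -> R) : Prop :=
  {within U, continuous f} /\
  match k with
  | 0%N => True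
  | k'.+1 => forall i : 'I_n,
      (forall x, U x -> derivable f x (delta_mx 0 i)) /\
      Ck_on k' U (fun x => 'D_(delta_mx 0 i) f x)
  end.

Definition smooth_on (n : nat) (U : set 'rV[R]_n) (f : 'rV[R]_n -> R) : Prop :=
  forall k, Ck_on k U f.

Definition is_lebesgue_measure (n : nat)
    (leb : {measure set (borel 'rV[R]_n) -> \bar R}) : Prop :=
  forall a b : 'rV[R]_n, (forall i, a 0 i <= b 0 i) ->
    leb [set x : 'rV[R]_n | forall i, a 0 i < x 0 i <= b 0 i] =
    (\prod_(i < n) (b 0 i - a 0 i))%:E.

End Smooth.

Section Manifold.
Context {R : realType} {X : ptopologicalType} {n : nat}.

(* [chart_fun] is only meaningful on [chart_dom], and [chart_inv] only on
   [chart_cod]. *)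
Record chart := Chart {
  chart_dom : set X;
  chart_fun : X -> 'rV[R]_n;
  chart_inv : 'rV[R]_n -> X }.

Definition chart_cod (c : chart) : set 'rV[R]_n := chart_fun c @` chart_dom c.

Definition is_chart (c : chart) : Prop :=
  [/\ open (chart_dom c), open (chart_cod c),
      {within chart_dom c, continuous (chart_fun c)},
      {within chart_cod c, continuous (chart_inv c)} &
      forall x, chart_dom c x -> chart_inv c (chart_fun c x) = x].

Definition smooth_atlas (A : set chart) : Prop :=
  [/\ forall c, A c -> is_chart c,
      forall x, exists2 c, A c & chart_dom c x &
      forall c c', A c -> A c' -> forall i : 'I_n,
        smooth_on (chart_fun c @` (chart_dom c `&` chart_dom c'))
                  (fun y => chart_fun c' (chart_inv c y) 0 i)].

Definition smooth (A : set chart) (f : X -> R[i]) : Prop :=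
  forall c, A c ->
    smooth_on (chart_cod c) (fun y => complex.Re (f (chart_inv c y))) /\
    smooth_on (chart_cod c) (fun y => complex.Im (f (chart_inv c y))).

Definition smooth_positive_density (A : set chart)
    (mu : {measure set (borel X) -> \bar R}) : Prop :=
  exists2 leb : {measure set (borel 'rV[R]_n) -> \bar R},
    is_lebesgue_measure leb &
    forall c, A c -> exists rho : 'rV[R]_n -> R,
      [/\ smooth_on (chart_cod c) rho,
          forall y, chart_cod c y -> 0 < rho y &
          forall B : set (borel X), measurable B -> B `<=` chart_dom c ->
            (mu B = \int[leb]_(y in chart_fun c @` B) (rho y)%:E)%E].

End Manifold.
Arguments chart : clear implicits.

Section L2.
Context {R : realType} {X : ptopologicalType}.
Variable mu : {measure set (borel X) -> \bar R}.
Implicit Types f g : X -> R[i].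

Definition sqnormL2 f : \bar R := (\int[mu]_x (normc (f x) ^+ 2)%:E)%E.

Definition L2 f : Prop :=
  [/\ measurable_fun setT (fun x : borel X => complex.Re (f x)),
      measurable_fun setT (fun x : borel X => complex.Im (f x)) &
      (sqnormL2 f < +oo)%E].

Definition ipL2 f g : R[i] :=
  Complex (\int[mu]_x complex.Re (f x * (g x)^*%C))
          (\int[mu]_x complex.Im (f x * (g x)^*%C)).

Definition orthonormal_basis_L2 (I : countType) (e : I -> X -> R[i]) : Prop :=
  [/\ forall i, L2 (e i),
      forall i i', ipL2 (e i) (e i') = (i == i')%:R &
      forall f, L2 f -> forall eps : R, 0 < eps ->
        exists (s : seq I) (c : I -> R[i]),
          (sqnormL2 (fun x => f x - \sum_(i <- s) c i * e i x)%R < eps%:E)%E].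

Definition coefL2 (I : Type) (e : I -> X -> R[i]) f : I -> R[i] :=
  fun i => ipL2 f (e i).

End L2.

Section Hilbert.
Context {R : realType} {G : completeNormedModType R[i]}.
Variable ip : G -> G -> R[i].

(* Linear in the first argument; together with the completeness of [G] this
   makes [(G, ip)] a Hilbert space. *)
Definition hilbert_inner_product : Prop :=
  [/\ forall a x y z, ip (a *: x + y) z = a * ip x z + ip y z,
      forall x y, ip y x = (ip x y)^*%C &
      forall x, `|x| ^+ 2 = ip x x].

Definition orthonormal_basis (I : countType) (h : I -> G) : Prop :=
  (forall i i', ip (h i) (h i') = (i == i')%:R) /\
  dense [set x : G | exists (s : seq I) (c : I -> R[i]),
                       x = \sum_(i <- s) c i *: h i].

End Hilbert.

Section SequenceSpaces.
Context {R : realType}.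

Definition rsum (I : countType) (u : I -> R) : R :=
  fine (\esum_(i in [set: I]) ((EFin \o u)^\+ i)%E) -
  fine (\esum_(i in [set: I]) ((EFin \o u)^\- i)%E).

(* Meaningful only when the family [v i * a i] is absolutely summable. *)
Definition pairing (I : countType) (v a : I -> R[i]) : R[i] :=
  Complex (rsum (fun i => complex.Re (v i * a i)))
          (rsum (fun i => complex.Im (v i * a i))).

Definition alpha_dual (I : countType) (V : set (I -> R[i])) :
    set (I -> R[i]) :=
  [set a | forall v, V v ->
     (\esum_(i in [set: I]) (normc (v i) * normc (a i))%:E < +oo)%E].

(* Maps out of the space [V] are represented by total functions whose values
   outside [V] are irrelevant. *)
Definition sequential_linear (I J : countType)
    (V : set (I -> R[i])) (W : set (J -> R[i]))
    (phi : (I -> R[i]) -> (J -> R[i])) : Prop :=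
  [/\ forall v, V v -> W (phi v),
      forall (a : R[i]) u v, V u -> V v ->
        phi (fun i => a * u i + v i) = (fun j => a * phi u j + phi v j) &
      forall g, alpha_dual W g ->
        exists2 a, alpha_dual V a &
          forall v, V v -> pairing (phi v) g = pairing v a].

(* The index set of a family indexed by pairs [(j, l)] with [l < d j]; both
   indices start at 0. *)
Definition idx (d : nat -> nat) : countType := {j : nat & 'I_(d j)}.

Definition mkidx (d : nat -> nat) (j : nat) (l : 'I_(d j)) : idx d :=
  Tagged (fun j => 'I_(d j)) l.

Definition spectral_data (d : nat -> nat) (lam : nat -> R) : Prop :=
  [/\ forall j, (0 < d j)%N,
      forall j, 0 < lam j,
      forall j, lam j <= lam j.+1 &
      exists2 s0 : R, 0 < s0 &
        (\sum_(0 <= j <oo) ((d j)%:R * lam j `^ (- s0))%:E < +oo)%E].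

Definition rapid_decay (d : nat -> nat) (lam : nat -> R)
    (c : idx d -> R[i]) : Prop :=
  forall s : R,
    (\sum_(0 <= j <oo) (lam j `^ (2 * s) *
        \sum_(l < d j) normc (c (mkidx l)) ^+ 2)%:E < +oo)%E.

End SequenceSpaces.

Section HinfE.
Context {R : realType} {X : ptopologicalType} {n : nat}.
Variables (A : set (chart R X n)) (mu : {measure set (borel X) -> \bar R}).
Variables (d : nat -> nat) (lam : nat -> R) (e : idx d -> X -> R[i]).

(* H^oo_E as a set of square integrable functions, closed under a.e. equality *)
Definition HinfE (phi : X -> R[i]) : Prop :=
  L2 mu phi /\ rapid_decay lam (coefL2 mu e phi).

(* H^oo_E = C^oo(X) inside L^2(X), i.e. modulo a.e. equality *)
Definition HinfE_eq_smooth : Prop :=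
  forall phi, L2 mu phi ->
    (HinfE phi <->
     exists2 psi, smooth A psi & {ae mu, forall x : borel X, phi x = psi x}).

(* the smooth representatives of the elements of H^oo_E, as genuine functions
   on X *)
Definition HinfE_fun (phi : X -> R[i]) : Prop := smooth A phi /\ HinfE phi.

Definition HinfE_seq : set (idx d -> R[i]) :=
  [set c | exists2 phi, HinfE phi & c = coefL2 mu e phi].

Definition HinfE_mapping (J : countType) (W : set (J -> R[i]))
    (f : X -> (J -> R[i])) : Prop :=
  (forall x, W (f x)) /\
  forall u, alpha_dual W u -> HinfE_fun (fun x => pairing (f x) u).

Definition is_delta (delta : X -> (idx d -> R[i])) : Prop :=
  forall x, alpha_dual HinfE_seq (delta x) /\
    forall phi, HinfE_fun phi ->
      pairing (coefL2 mu e phi) (delta x) = phi x.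

End HinfE.

Section GinfF.
Context {R : realType} {G : completeNormedModType R[i]}.
Variables (ip : G -> G -> R[i]) (g : nat -> nat) (nu : nat -> R).
Variable h : idx g -> G.

Definition GinfF_seq : set (idx g -> R[i]) :=
  [set c | rapid_decay nu c /\ exists psi : G, c = (fun k => ip psi (h k))].

End GinfF.

(* Main.v *)
Require Import Defs.
From HB Require Import structures.
From mathcomp Require Import all_boot all_order all_algebra.
From mathcomp Require Import complex.
From mathcomp Require Import all_classical all_reals all_analysis.
From mathcomp Require Import measurable_realfun.
From mathcomp Require Import ring lra.

Import Order.TTheory GRing.Theory Num.Theory.
Import numFieldNormedType.Exports.
Import ComplexField.Normc.

Local Open Scope classical_set_scope.
Local Open Scope ring_scope.

(** Write rapid for the space of families that remain absolutely summable after
    multiplication by every power of the spectral weight.  The summability of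
    d_j lambda_j^(-s_0) allows the passage between l^1 and l^2 conditions, and
    the series sum c_i e_i converges in L^2 when c is rapid, so both
    coefficient spaces in the theorem are rapid spaces ([HinfE_seqE],
    [GinfF_seqE]).  All powers of the weight lie in the dual of such a space;
    hence rapid spaces are perfect ([rapid_perfect]).

    The only analytic difficulty is uniformity: H^oo_E = C^oo(X) is an equality
    of sets and says nothing about topologies.  Continuity is recovered from
    one elementary uniform boundedness principle, [gliding_hump]: if functionals
    on a sequence space are pointwise bounded on all families dominated by b,
    then their coordinates, weighted by b, are uniformly bounded.  It is used
    three times.

    Over the averages on sets of positive measure, it bounds the averages of
    e_i, because every smooth function on X is bounded.  A continuous function
    is controlled by its averages, since open sets have positive measure;
    consequently |c_i e_i(x)| is summable, uniformly in x, for the smooth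
    representatives e_i, and f(x) is the sum of its expansion
    ([pointwise_expansion]).  So delta_x is the family e_i(x), and testing on
    the e_i shows that nothing else is possible.  An element a of the bidual of
    H^oo_E is by perfectness the coefficient family of a smooth f, and pairing
    it with delta_x gives f(x) ([bidual_function]).  This is (i), and (ii)
    follows since composing a sequential linear map with a functional gives an
    element of the bidual.

    For (iii) let f be an H^oo_E-mapping and let row k be the coefficient
    family of its component f_k.  The extension must send v to the family of
    all <v, row k>.  Over the points of X, the principle makes sum u_k f_k
    uniformly convergent for u in the dual of G^oo_F, so that the coefficients
    of <f, u> are sum_k u_k row_k ([coef_pairing]).  Over the index of the basis
    of H, it then makes the double family u_k row_k,i v_i absolutely summable
    for u and v in the two duals ([matrix_summable]).  Exchanging the sums shows
    that the extension has values in G^oo_F and is sequential.  It is unique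
    because every functional involved is the pairing with the coefficients of
    a smooth function, which is known once its values at the delta_x are. *)

Set Implicit Arguments.
Unset Strict Implicit.
Unset Printing Implicit Defensive.

(** * Absolutely summable real families *)

Section RealSums.
Context {R : realType} {I : countType}.
Implicit Types u v a b : I -> R.

Definition asum u : Prop := (\esum_(i in [set: I]) (`|u i|)%:E < +oo)%E.

Lemma asumE u : asum u -> (\esum_(i in [set: I]) (`|u i|)%:E \is a fin_num)%E.
Proof. by move=> su; rewrite ge0_fin_numE// esum_ge0// => i _; rewrite lee_fin. Qed.

Lemma asum_le u v : (forall i, `|u i| <= v i) -> asum v -> asum u.
Proof.
move=> uv; apply: le_lt_trans; apply: le_esum => i _; rewrite lee_fin.
exact: le_trans (uv i) (ler_norm _).
Qed.

Lemma asumD u v : asum u -> asum v -> asum (fun i => u i + v i).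
Proof.
move=> su sv; apply: le_lt_trans (lte_add_pinfty su sv).
by rewrite -esumD//; apply: le_esum => i _; rewrite -EFinD lee_fin ler_normD.
Qed.

Lemma asumZ (c : R) u : asum u -> asum (fun i => c * u i).
Proof.
move=> su; have c0 : 0 <= `|c| by [].
rewrite /asum; apply: (@le_lt_trans _ _ (`|c|%:E * \esum_(i in [set: I]) (`|u i|)%:E)%E).
  apply: ge_ereal_sup => _ [F [finF _] <-].
  rewrite (_ : (\sum_(i \in F) _)%E = (`|c|%:E * \sum_(i \in F) (`|u i|)%:E)%E); last first.
    rewrite ge0_mule_fsumr//; apply: eq_fsbigr => i _.
    by rewrite normrM EFinM.
  rewrite lee_wpmul2l ?lee_fin// -esum_fset//.
  by apply: ge_ereal_sup => _ [F' [finF' _] <-]; apply: ereal_sup_ubound; exists F'.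
by rewrite lte_mul_pinfty// asumE.
Qed.

Lemma asumN u : asum u -> asum (fun i => - u i).
Proof. by apply: le_lt_trans; apply: le_esum => i _; rewrite normrN. Qed.

Lemma asumB u v : asum u -> asum v -> asum (fun i => u i - v i).
Proof. by move=> su /asumN; apply: asumD. Qed.

Lemma asum_norm u : asum u -> asum (fun i => `|u i|).
Proof. by apply: le_lt_trans; apply: le_esum => i _; rewrite normr_id. Qed.

Lemma asum_bounded u (K : R) :
  (forall s : seq I, uniq s -> \sum_(i <- s) `|u i| <= K) -> asum u.
Proof.
move=> uK; apply: (@le_lt_trans _ _ K%:E); last exact: ltry.
apply: ge_ereal_sup => _ [F [finF _] <-].
by rewrite fsbig_finite//= sumEFin lee_fin; apply: uK; exact: finmap.fset_uniq.
Qed.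

Lemma eq_rsum u v : u =1 v -> rsum u = rsum v.
Proof. by move=> /funext ->. Qed.

Lemma rsum_ge0E u : (forall i, 0 <= u i) ->
  rsum u = fine (\esum_(i in [set: I]) (u i)%:E).
Proof.
move=> u0; rewrite /rsum [X in _ - fine X]esum1 ?subr0; last first.
  by move=> i _; rewrite funenegE/=; apply/max_idPr; rewrite lee_fin oppr_le0.
by congr fine; apply: eq_esum => i _; rewrite funeposE; apply/max_idPl; rewrite lee_fin.
Qed.

Lemma rsumE u : (forall i, 0 <= u i) -> asum u ->
  ((rsum u)%:E = \esum_(i in [set: I]) (u i)%:E)%E.
Proof.
move=> u0 su; rewrite rsum_ge0E// fineK//.
have := asumE su; under eq_esum do rewrite ger0_norm//.
by [].
Qed.

Lemma rsum_ge0 u : (forall i, 0 <= u i) -> 0 <= rsum u.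
Proof.
by move=> u0; rewrite rsum_ge0E// fine_ge0// esum_ge0// => i _; rewrite lee_fin.
Qed.

Lemma le_rsum u v : (forall i, 0 <= u i) -> asum v -> (forall i, u i <= v i) ->
  rsum u <= rsum v.
Proof.
move=> u0 sv uv; have v0 i : 0 <= v i by exact: le_trans (uv i).
have su : asum u by apply: (asum_le _ sv) => i; rewrite ger0_norm.
by rewrite -lee_fin !rsumE//; apply: le_esum => i _; rewrite lee_fin.
Qed.

(** Every representation of a family as a difference of nonnegative summable
    families computes its sum, not only that by positive and negative parts;
    additivity follows by choosing representations. *)
Lemma rsum_ge0B u v : (forall i, 0 <= u i) -> (forall i, 0 <= v i) ->
  asum u -> asum v -> rsum (fun i => u i - v i) = rsum u - rsum v.
Proof.
move=> u0 v0 su sv; apply: EFin_inj; rewrite [RHS]EFinB (rsumE u0 su) (rsumE v0 sv) -esumB//;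
  try by move=> i _; rewrite lee_fin.
have suv : asum (fun i => u i - v i) by exact: asumB.
rewrite /rsum EFinB !fineK//; rewrite ge0_fin_numE ?esum_ge0//;
  apply: le_lt_trans suv; apply: le_esum => i _.
- by rewrite funenegE/= ge_max !lee_fin normr_ge0 andbT -normrN ler_norm.
- by rewrite funeposE/= ge_max !lee_fin normr_ge0 andbT ler_norm.
Qed.

Let pos u i := Num.max (u i) 0.
Let neg u i := Num.max (- u i) 0.
Let pos0 u i : 0 <= pos u i. Proof. by rewrite le_max lexx orbT. Qed.
Let neg0 u i : 0 <= neg u i. Proof. by rewrite le_max lexx orbT. Qed.
Let posneg u i : u i = pos u i - neg u i.
Proof. rewrite /pos /neg; case: leP => h; case: leP => k; lra. Qed.
Let asum_pos u : asum u -> asum (pos u).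
Proof.
apply: le_lt_trans; apply: le_esum => i _; rewrite lee_fin ger0_norm//.
by rewrite ge_max ler_norm normr_ge0.
Qed.
Let asum_neg u : asum u -> asum (neg u).
Proof.
apply: le_lt_trans; apply: le_esum => i _; rewrite lee_fin ger0_norm//.
by rewrite ge_max -normrN ler_norm normr_ge0.
Qed.

Lemma rsum_ge0D u v : (forall i, 0 <= u i) -> (forall i, 0 <= v i) ->
  asum u -> asum v -> rsum (fun i => u i + v i) = rsum u + rsum v.
Proof.
move=> u0 v0 su sv; apply: EFin_inj; rewrite [RHS]EFinD !rsumE//.
- by rewrite -esumD//; move=> i _; rewrite lee_fin.
- by move=> i; rewrite addr_ge0.
- exact: asumD.
Qed.

Lemma rsumB u v : asum u -> asum v -> rsum (fun i => u i - v i) = rsum u - rsum v.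
Proof.
move=> su sv.
have split w : asum w -> rsum w = rsum (pos w) - rsum (neg w).
  move=> sw; rewrite -rsum_ge0B//; [|exact: asum_pos|exact: asum_neg].
  by apply: eq_rsum => i; exact: posneg.
rewrite [rsum u]split// [rsum v]split//.
transitivity (rsum (fun i => (neg v i + pos u i) - (neg u i + pos v i))).
  by apply: eq_rsum => i; rewrite [u i]posneg [v i]posneg; lra.
have [? ? ? ?] : [/\ asum (pos u), asum (neg u), asum (pos v) & asum (neg v)].
  by split; [exact: asum_pos|exact: asum_neg|exact: asum_pos|exact: asum_neg].
rewrite rsum_ge0B ?rsum_ge0D//; first by lra.
- by move=> i; rewrite addr_ge0.
- by move=> i; rewrite addr_ge0.
- exact: asumD.
- exact: asumD.
Qed.

Lemma rsum0 : rsum (fun _ : I => 0 : R) = 0.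
Proof. by rewrite rsum_ge0E//= esum1. Qed.

Lemma asum0 : asum (fun _ : I => 0).
Proof. by rewrite /asum esum1 ?ltry// => i _; rewrite normr0. Qed.

Lemma rsumN u : asum u -> rsum (fun i => - u i) = - rsum u.
Proof.
move=> su; rewrite -[RHS]sub0r -[X in X - _]rsum0 -rsumB//; last exact: asum0.
by apply: eq_rsum => i; rewrite sub0r.
Qed.

Lemma rsumD u v : asum u -> asum v -> rsum (fun i => u i + v i) = rsum u + rsum v.
Proof.
move=> su sv; rewrite -[rsum v]opprK -rsumN// -rsumB//; last exact: asumN.
by apply: eq_rsum => i; rewrite opprK.
Qed.

Let rsum_ge0Z (c : R) u : 0 <= c -> (forall i, 0 <= u i) -> asum u ->
  rsum (fun i => c * u i) = c * rsum u.
Proof.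
move=> c0 u0 su.
have le_cu (k : R) w : 0 <= k -> (forall i, 0 <= w i) -> asum w ->
    rsum (fun i => k * w i) <= k * rsum w.
  move=> k0 w0 sw; rewrite -lee_fin EFinM !rsumE//; last 2 first.
    by move=> i; rewrite mulr_ge0.
    exact: asumZ.
  apply: ge_ereal_sup => _ [F [finF _] <-].
  under eq_fsbigr do rewrite EFinM.
  rewrite -ge0_mule_fsumr; last by move=> i; rewrite lee_fin.
  rewrite lee_wpmul2l// ?lee_fin//.
  by apply: ereal_sup_ubound; exists F.
apply/eqP; rewrite eq_le le_cu//=.
have [->|c_neq0] := eqVneq c 0.
  by rewrite mul0r (eq_rsum (fun i => mul0r _)) rsum0.
rewrite -ler_pdivlMl ?lt_def ?c_neq0//.
apply: le_trans (le_cu c^-1 (fun i => c * u i) _ _ _); last 3 first.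
- by rewrite invr_ge0.
- by move=> i; rewrite mulr_ge0.
- exact: asumZ.
by apply: le_rsum => //; [exact/asumZ/asumZ|move=> i; rewrite mulKf].
Qed.

Lemma rsumZ (c : R) u : asum u -> rsum (fun i => c * u i) = c * rsum u.
Proof.
wlog c0 : c / 0 <= c => [hw|] su.
  have [|c0] := leP 0 c; first by move=> c0; exact: hw.
  rewrite -[RHS]opprK -mulNr -hw ?oppr_ge0// ?ltW// -rsumN; last exact: asumZ.
  by apply: eq_rsum => i; rewrite mulNr opprK.
have [? ?] : asum (pos u) /\ asum (neg u).
  by split; [exact: asum_pos|exact: asum_neg].
rewrite (eq_rsum (posneg u)) rsumB// mulrBr -!rsum_ge0Z// -rsumB.
- by apply: eq_rsum => i; rewrite {1}posneg mulrBr.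
- exact: asumZ.
- exact: asumZ.
Qed.

Lemma ler_norm_rsum u v : (forall i, `|u i| <= v i) -> asum v -> `|rsum u| <= rsum v.
Proof.
move=> uv sv.
have su : asum u by exact: (asum_le uv).
have -> : rsum u = rsum (pos u) - rsum (neg u).
  rewrite -rsum_ge0B//; [|exact: asum_pos|exact: asum_neg].
  by apply: eq_rsum => i; exact: posneg.
have le_v : rsum (pos u) + rsum (neg u) <= rsum v.
  rewrite -rsum_ge0D//; [|exact: asum_pos|exact: asum_neg].
  apply: le_rsum => // i; first by rewrite addr_ge0.
  apply: le_trans (uv i); rewrite /pos /neg.
  have [h|h] := leP (u i) 0; have [k|k] := leP (- u i) 0; rewrite ?add0r ?addr0 ?normr_ge0//.
  - by rewrite -normrN ler_norm.
  - by rewrite ler_norm.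
  - lra.
apply: le_trans le_v; rewrite (le_trans (ler_normB _ _))//.
by rewrite !ger0_norm// rsum_ge0.
Qed.

Lemma asum_supp1 u i0 : (forall i, i != i0 -> u i = 0) -> asum u.
Proof.
move=> u0; apply: (asum_bounded (K := `|u i0|)) => s us.
have [i0s|i0s] := boolP (i0 \in s).
  rewrite (bigD1_seq i0)//= big1 ?addr0// => i ii0.
  by rewrite u0// normr0.
rewrite big1_seq ?normr_ge0// => i /andP[_ is_].
by rewrite u0 ?normr0//; apply: contraNneq i0s => <-.
Qed.

Lemma rsum_supp1 u i0 : (forall i, i != i0 -> u i = 0) -> rsum u = u i0.
Proof.
move=> u0; have su := asum_supp1 u0.
have pE (w : I -> R) : (forall i, 0 <= w i) -> (forall i, i != i0 -> w i = 0) ->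
    rsum w = w i0.
  move=> w0 wE; rewrite rsum_ge0E// (esumID [set i0]); last first.
    by move=> i _; rewrite lee_fin.
  rewrite setTI esum_set1 ?lee_fin// esum1 ?adde0//.
  by move=> i [_ /eqP /wE ->].
rewrite (eq_rsum (posneg u)) rsumB; [|exact: asum_pos|exact: asum_neg].
by rewrite !pE// => i /u0; rewrite /pos /neg => ->; rewrite ?oppr0 maxxx.
Qed.

Lemma rsum_sum (T : Type) (s : seq T) (u : T -> I -> R) :
  (forall t, asum (u t)) ->
  asum (fun i => \sum_(t <- s) u t i) /\
  rsum (fun i => \sum_(t <- s) u t i) = \sum_(t <- s) rsum (u t).
Proof.
move=> su; elim: s => [|t s [IHa IHr]].
  by under eq_fun do rewrite big_nil; rewrite big_nil; split; [exact: asum0|exact: rsum0].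
under eq_fun do rewrite big_cons; rewrite big_cons.
by split; [exact: asumD|rewrite rsumD// IHr].
Qed.

Lemma asum_coef u i : asum u -> `|u i| <= rsum (fun i => `|u i|).
Proof.
move=> su; rewrite -lee_fin rsumE//; last exact: asum_norm.
rewrite (esumID [set i])// setTI esum_set1// leeDl//.
by apply: esum_ge0.
Qed.

Lemma rsum_mem u (s : seq I) : uniq s ->
  asum (fun i => if i \in s then u i else 0) /\
  rsum (fun i => if i \in s then u i else 0) = \sum_(i <- s) u i.
Proof.
move=> us; pose w t i := if i == t then u i else 0.
have wE t i : i != t -> w t i = 0 by rewrite /w => /negPf ->.
have sumw : (fun i => if i \in s then u i else 0) = (fun i => \sum_(t <- s) w t i).
  apply/funext => i; case: ifPn => is_.
    rewrite (bigD1_seq i)//= big1 ?addr0 /w ?eqxx// => t ti.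
    by rewrite eq_sym (negPf ti).
  rewrite big1_seq// => t /andP[_ ts]; rewrite wE//.
  by apply: contraNneq is_ => ->.
have [sa se] := @rsum_sum _ s w (fun t => asum_supp1 (wE t)).
rewrite sumw; split=> //; rewrite se; apply: eq_bigr => t _.
by rewrite (rsum_supp1 (wE t)) /w eqxx.
Qed.

Lemma asum_cond u (P : pred I) : asum u -> asum (fun i => if P i then u i else 0).
Proof.
move=> su; apply: asum_le (asum_norm su) => i.
by case: ifP => _; rewrite ?normr0.
Qed.

Lemma rsum_split u (s : seq I) : uniq s -> asum u ->
  rsum u = \sum_(i <- s) u i + rsum (fun i => if i \in s then 0 else u i).
Proof.
move=> us su; have [sa <-] := rsum_mem u us; rewrite -rsumD//.
- by apply: eq_rsum => i; case: ifP => _; rewrite ?addr0 ?add0r.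
- have := @asum_cond u (fun i => i \notin s) su.
  by under eq_fun do rewrite if_neg.
Qed.

Lemma asum_tail u (eps : R) : 0 < eps -> (forall i, 0 <= u i) -> asum u ->
  exists2 s : seq I, uniq s & rsum (fun i => if i \in s then 0 else u i) <= eps.
Proof.
move=> eps0 u0 su.
have /ereal_sup_gt[_ [F [finF _] <-]] :
    ((rsum u - eps)%:E < \esum_(i in [set: I]) (u i)%:E)%E.
  by rewrite -rsumE// lte_fin ltrBlDr ltrDl.
rewrite fsbig_finite//= sumEFin lte_fin => h.
exists (finmap.enum_fset (fset_set F)); first exact: finmap.fset_uniq.
have := @rsum_split u (finmap.enum_fset (fset_set F)) (finmap.fset_uniq _) su.
by lra.
Qed.

End RealSums.

Section DoubleSums.
Context {R : realType} {I J : countType}.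
Implicit Types u : I -> J -> R.

Lemma esum_swap (a : I -> J -> \bar R) : (forall i j, (0 <= a i j)%E) ->
  (\esum_(i in [set: I]) \esum_(j in [set: J]) a i j =
   \esum_(j in [set: J]) \esum_(i in [set: I]) a i j)%E.
Proof.
move=> a0; rewrite !esum_esum//.
rewrite (reindex_esum ([set: J] `*` [set: I]) _ (fun x => (x.2, x.1)))//.
split => //=.
- by move=> [i1 i2] [j1 j2] /= _ _ [] -> ->.
- by move=> [i j] _ /=; exists (j, i).
Qed.

Definition dsum u : Prop :=
  (\esum_(i in [set: I]) \esum_(j in [set: J]) (`|u i j|)%:E < +oo)%E.

Lemma dsum_asum u i : dsum u -> asum (u i).
Proof.
apply: le_lt_trans; apply: esum_ge; exists [set i]; first by split.
by rewrite fsbig_set1.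
Qed.

Lemma dsum_rsum u : dsum u -> asum (fun i => rsum (fun j => `|u i j|)).
Proof.
move=> su; apply: le_lt_trans su; apply: le_esum => i _.
have [e|e] := pselect (asum (u i)).
  by rewrite ger0_norm ?rsum_ge0// rsumE//; exact: asum_norm.
have -> : (\esum_(j in [set: J]) (`|u i j|)%:E = +oo)%E.
  by apply/eqP; rewrite -leye_eq leNgt; apply/negP.
by rewrite leey.
Qed.

Lemma dsum_iter u : (forall i, asum (u i)) ->
  asum (fun i => rsum (fun j => `|u i j|)) -> dsum u.
Proof.
move=> ui; apply: le_lt_trans; apply: le_esum => i _.
by rewrite ger0_norm ?rsum_ge0// rsumE//; exact: asum_norm.
Qed.

Lemma dsum_prod u (K : R) (a : I -> R) (b : J -> R) :
  (forall i j, `|u i j| <= K * a i * b j) -> asum a -> asum b -> dsum u.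
Proof.
move=> uab sa sb.
apply: dsum_iter => [i|]; first by apply: asum_le (uab i) _; exact: asumZ.
apply: (@asum_le _ _ _ (fun i => (`|K| * rsum (fun j => `|b j|)) * `|a i|)).
  move=> i; rewrite ger0_norm ?rsum_ge0//.
  rewrite mulrAC -rsumZ; last exact: asum_norm.
  apply: le_rsum => //; first by apply: asumZ; exact: asum_norm.
  by move=> j; apply: le_trans (uab i j) _; rewrite -!normrM ler_norm.
by apply: asumZ; exact: asum_norm.
Qed.

Let ge0_exchange u : (forall i j, 0 <= u i j) -> dsum u ->
  [/\ asum (fun i => rsum (u i)), forall j, asum (u^~ j),
      asum (fun j => rsum (u^~ j)) &
      rsum (fun i => rsum (u i)) = rsum (fun j => rsum (u^~ j))].
Proof.
move=> u0 su.
have su' : (\esum_(j in [set: J]) \esum_(i in [set: I]) (`|u i j|)%:E < +oo)%E.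
  by rewrite -(esum_swap (a := fun i j => (`|u i j|)%:E)).
have c j : asum (u^~ j).
  apply: le_lt_trans su'; apply: esum_ge; exists [set j]; first by split.
  by rewrite fsbig_set1.
have s1 : asum (fun i => rsum (u i)).
  have := dsum_rsum su; congr asum; apply/funext => i.
  by apply: eq_rsum => j; rewrite ger0_norm.
have s2 : asum (fun j => rsum (u^~ j)).
  apply: le_lt_trans su'; apply: le_esum => j _.
  rewrite ger0_norm ?rsum_ge0// rsumE//.
  by apply: le_esum => i _; rewrite ger0_norm.
split=> //; apply: EFin_inj; rewrite (rsumE _ s1); last by move=> i; exact: rsum_ge0.
rewrite (rsumE _ s2); last by move=> i; exact: rsum_ge0.
transitivity (\esum_(i in [set: I]) \esum_(j in [set: J]) (u i j)%:E)%E.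
  by apply: eq_esum => i _; rewrite rsumE//; exact: dsum_asum.
rewrite (esum_swap (a := fun i j => (u i j)%:E))//.
by apply: eq_esum => j _; rewrite rsumE//.
Qed.

(** Tonelli applies to the two nonnegative families |u| and |u| - u. *)
Lemma rsum_exchange u : dsum u ->
  [/\ asum (fun i => rsum (u i)), forall j, asum (u^~ j),
      asum (fun j => rsum (u^~ j)) &
      rsum (fun i => rsum (u i)) = rsum (fun j => rsum (u^~ j))].
Proof.
move=> su.
pose p i j := `|u i j|; pose q i j := `|u i j| - u i j.
have p0 i j : 0 <= p i j by rewrite /p.
have q0 i j : 0 <= q i j by rewrite /q subr_ge0 ler_norm.
have sp : dsum p.
  by apply: le_lt_trans su; apply: le_esum => i _; apply: le_esum => j _; rewrite normr_id.
have sq : dsum q.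
  apply: dsum_iter => [i|].
    by apply: asumB; [exact: (dsum_asum i sp)|exact: (dsum_asum i su)].
  apply: (@asum_le _ _ _ (fun i => 2 * rsum (p i))); last first.
    apply: asumZ; have := dsum_rsum su; exact.
  move=> i; rewrite ger0_norm ?rsum_ge0// -rsumZ; last exact: (dsum_asum i sp).
  apply: le_rsum => //; first by apply: asumZ; exact: (dsum_asum i sp).
  move=> j; rewrite ger0_norm// /q /p mulr2n mulrDl mul1r lerD2l.
  by rewrite -normrN ler_norm.
have [p1 p2 p3 p4] := ge0_exchange p0 sp.
have [q1 q2 q3 q4] := ge0_exchange q0 sq.
have uE i j : u i j = p i j - q i j by rewrite /p /q opprB addrC subrK.
have uI : (fun i => rsum (u i)) = (fun i => rsum (p i) - rsum (q i)).
  apply/funext => i; rewrite (eq_rsum (uE i)) rsumB//; exact: dsum_asum.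
have uJ : (fun j => rsum (u^~ j)) = (fun j => rsum (p^~ j) - rsum (q^~ j)).
  by apply/funext => j; rewrite (eq_rsum (fun i => uE i j)) rsumB.
rewrite uI uJ; split; [exact: asumB| |exact: asumB|by rewrite [LHS]rsumB// [RHS]rsumB//; congr (_ - _)].
move=> j; rewrite (_ : u^~ j = fun i => p i j - q i j); first exact: asumB.
by apply/funext => i.
Qed.

End DoubleSums.

(** * Uniform boundedness by a gliding hump *)

Section GlidingHump.
Context {R : realType}.

Lemma rsum_le_bound (I : countType) (u : I -> R) (K : R) :
  (forall i, 0 <= u i) -> (forall s : seq I, uniq s -> \sum_(i <- s) u i <= K) ->
  rsum u <= K.
Proof.
move=> u0 uK; rewrite -lee_fin rsumE//; last first.
  apply: (@asum_bounded _ _ _ K) => s us; rewrite (eq_bigr u); first exact: uK.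
  by move=> i _; rewrite ger0_norm.
apply: ge_ereal_sup => _ [F [finF _] <-].
by rewrite fsbig_finite//= sumEFin lee_fin; apply: uK; exact: finmap.fset_uniq.
Qed.

Lemma ler_sum_uniq_nat (v : nat -> R) (s : seq nat) (K : R) : uniq s ->
  (forall j, 0 <= v j) -> (forall M, \sum_(0 <= j < M) v j <= K) ->
  \sum_(j <- s) v j <= K.
Proof.
move=> us v0 vK; pose M := (\max_(j <- s) j).+1.
apply: le_trans (vK M); rewrite /index_iota subn0.
have -> : \sum_(j <- s) v j = \sum_(j <- [seq j <- iota 0 M | j \in s]) v j.
  apply: perm_big; apply: uniq_perm => //; first by rewrite filter_uniq// iota_uniq.
  move=> j; rewrite mem_filter mem_iota add0n/=.
  case: (boolP (j \in s)) => //= js; rewrite ltnS.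
  by apply/esym; exact: (@leq_bigmax_seq _ s xpredT id).
rewrite big_filter [leRHS](bigID (fun j => j \in s))/= lerDl.
by apply: sumr_ge0.
Qed.

(** The ratio 1/3 makes the weights after the [k]-th one add up to half of the
    [k]-th, so that a term within 3/4 of the largest one outweighs the tail. *)
Definition hump_weight (k : nat) : R := 3^-1 ^+ k.+1.
Local Notation w := hump_weight.

Lemma hump_weight_gt0 k : 0 < w k.
Proof. by rewrite /w exprn_gt0// invr_gt0. Qed.

Lemma hump_weight_tail k :
  asum (fun j => if (j < k)%N then 0 else w j) /\
  rsum (fun j => if (j < k)%N then 0 else w j) <= 3^-1 ^+ k / 2.
Proof.
have v0 j : 0 <= (if (j < k)%N then 0 else w j).
  by case: ifP => // _; exact/ltW/hump_weight_gt0.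
have key M : \sum_(0 <= j < M) (if (j < k)%N then 0 else w j) +
    3^-1 ^+ (maxn k M) / 2 <= 3^-1 ^+ k / 2.
  elim: M => [|M IH]; first by rewrite big_geq// add0r maxn0.
  rewrite big_nat_recr//=; case: ltnP => kM.
    rewrite addr0; have -> : maxn k M.+1 = k by apply/maxn_idPl.
    by move: IH; have -> : maxn k M = k by apply/maxn_idPl/ltnW.
  have -> : maxn k M.+1 = M.+1 by apply/maxn_idPr; rewrite ltnW.
  move: IH; have -> : maxn k M = M by apply/maxn_idPr.
  rewrite /w; rewrite exprS; set x := 3^-1 ^+ M; lra.
have vK s : uniq s -> \sum_(j <- s) (if (j < k)%N then 0 else w j) <= 3^-1 ^+ k / 2.
  move=> us; apply: ler_sum_uniq_nat => // M; apply: le_trans (key M).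
  by rewrite lerDl divr_ge0// exprn_ge0// invr_ge0.
split; last exact: rsum_le_bound.
apply: asum_bounded => s us; rewrite (eq_bigr (fun j => if (j < k)%N then 0 else w j)).
  exact: vK.
by move=> j _; rewrite ger0_norm.
Qed.

(** Each sign is chosen so that the new term does not cancel the sum of the
    previous ones; that sum depends on earlier signs only, hence the recursion. *)
Lemma sign_choice (a : nat -> nat -> R) : exists sg : nat -> R,
  (forall j, `|sg j| = 1) /\
  forall k, `|a k k| <= `|\sum_(0 <= j < k.+1) sg j * a k j|.
Proof.
pose S k (sg : nat -> R) := \sum_(0 <= j < k) sg j * a k j.
pose pick k (sg : nat -> R) : R := if 0 <= S k sg * a k k then 1 else -1.
pose fix tau k : nat -> R := if k is k'.+1 then
  fun j => if j == k' then pick k' (tau k') else tau k' j else fun=> 1.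
pose sg j := tau j.+1 j.
have tauE k j : (j < k)%N -> tau k j = sg j.
  elim: k => // k IH; rewrite ltnS leq_eqVlt => /predU1P[->//|jk].
  by rewrite /= (ltn_eqF jk) IH.
have sgE k : sg k = pick k sg.
  rewrite /sg/= eqxx /pick; congr (if 0 <= _ * _ then _ else _).
  by apply: eq_big_nat => j /andP[_ jk]; rewrite tauE.
exists sg; split=> [j|k]; first by rewrite sgE /pick; case: ifP; rewrite ?normrN normr1.
rewrite big_nat_recr//= -/(S k sg) sgE /pick; case: ifPn => h.
  rewrite mul1r -ler_sqr ?nnegrE// !real_normK ?num_real//.
  by rewrite sqrrD; have := sqr_ge0 (S k sg); nra.
rewrite -ltNge in h; rewrite mulN1r -ler_sqr ?nnegrE// !real_normK ?num_real//.
by rewrite sqrrB; have := sqr_ge0 (S k sg); nra.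
Qed.

Lemma bernoulli_43 k : 1 + k%:R / 3 <= (4 / 3 : R) ^+ k.
Proof.
elim: k => [|k IH]; first by rewrite mul0r addr0 expr0.
rewrite exprS -natr1; have : 0 <= (k%:R : R) by [].
set x := k%:R in IH *; set y := _ ^+ k in IH *; move=> x0; lra.
Qed.

(** If the conclusion fails, there are functionals [T (p k)] whose largest
    weighted coordinate [N k] exceeds 4^k.  The family [c] superposes multiples
    +- 3^-(k+1) b of unit vectors at coordinates [m k] where [N k] is almost
    attained.  Evaluating [T (p k)] at [c], the terms before [k] do not cancel
    the [k]-th, thanks to the signs, and those after it contribute at most two
    thirds of it.  The values are therefore at least of order (4/3)^k, and
    [c], which is dominated by [b], violates the pointwise bound. *)
Lemma gliding_hump (I : countType) (P : Type) (T : P -> I -> R) (b : I -> R) :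
  (forall i, 0 <= b i) ->
  (forall p, exists N : R, forall i, b i * `|T p i| <= N) ->
  (forall c : I -> R, (forall i, `|c i| <= b i) ->
     exists K : R, forall p, `|rsum (fun i => c i * T p i)| <= K) ->
  exists K : R, forall p i, b i * `|T p i| <= K.
Proof.
move=> b0 bddP bddc; apply: contrapT => unbdd.
have big K : exists p i, K < b i * `|T p i|.
  apply: contrapT => h; apply: unbdd; exists K => p i.
  by rewrite leNgt; apply/negP => h'; apply: h; exists p, i.
have step (k : nat) : exists z : P * I * R,
    [/\ forall i, b i * `|T z.1.1 i| <= z.2,
        3 / 4 * z.2 <= b z.1.2 * `|T z.1.1 z.1.2| & 4 ^+ k <= z.2].
  have [p [i0 pi0]] := big (4 ^+ k); have [N HN] := bddP p.
  pose A := [set b i * `|T p i| | i in [set: I]].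
  have hA : has_sup A.
    by split; [exists (b i0 * `|T p i0|), i0|exists N => _ [i _ <-]].
  have le_sup i : b i * `|T p i| <= sup A by apply: sup_upper_bound => //; exists i.
  have sup0 : 0 < sup A.
    by apply: lt_le_trans (le_sup i0); apply: le_lt_trans pi0; rewrite exprn_ge0.
  have e0 : 0 < sup A / 4 by rewrite divr_gt0.
  have [_ [i1 _ <-] hi1] := sup_adherent e0 hA.
  exists (p, i1, sup A); split=> //=; last exact/ltW/(lt_le_trans pi0)/le_sup.
  by lra.
(* Functionals, near-norming coordinates and weighted norms. *)
have [z Hz] := choice step.
pose p k := (z k).1.1; pose m k := (z k).1.2; pose N k := (z k).2.
have HN k i : b i * `|T (p k) i| <= N k by have [] := Hz k.
have Hm k : 3 / 4 * N k <= b (m k) * `|T (p k) (m k)| by have [] := Hz k.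
have N4 k : 4 ^+ k <= N k by have [] := Hz k.
have N0 k : 0 <= N k by apply: le_trans (N4 k); rewrite exprn_ge0.
pose t k j := b (m j) * T (p k) (m j).
have tN k j : `|t k j| <= N k by rewrite /t normrM (ger0_norm (b0 _)).
have [sg [sg1 sgP]] := sign_choice (fun k j => w j * t k j).
have w0 j : 0 <= w j by exact/ltW/hump_weight_gt0.
have [sw w2] := hump_weight_tail 0.
have {}sw : asum w by [].
have {}w2 : rsum w <= 2^-1 by move: w2; rewrite expr0 mul1r.
pose c i := rsum (fun j => w j * sg j * (if m j == i then b i else 0)).
have cb i : `|c i| <= b i.
  apply: (@le_trans _ _ (rsum (fun j => b i * w j))).
    apply: ler_norm_rsum; last exact: asumZ.
    move=> j; rewrite !normrM sg1 mulr1 (ger0_norm (w0 j)) mulrC ler_wpM2r//.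
    by case: ifP; rewrite ?normr0 ?ger0_norm.
  by rewrite rsumZ//; have := b0 i; nra.
have [K HK] := bddc c cb.
have cT k : rsum (fun i => c i * T (p k) i) = rsum (fun j => sg j * (w j * t k j)).
  pose u j i := w j * sg j * (if m j == i then b i else 0) * T (p k) i.
  have uS j i : i != m j -> u j i = 0.
    by rewrite /u eq_sym => /negPf ->; rewrite mulr0 mul0r.
  have uE j : rsum (u j) = sg j * (w j * t k j).
    by rewrite (rsum_supp1 (uS j)) /u eqxx /t; ring.
  have du : dsum u.
    apply: dsum_iter => [j|]; first exact: asum_supp1 (uS j).
    apply: (@asum_le _ _ _ (fun j => N k * w j)); last exact: asumZ.
    move=> j; rewrite (rsum_supp1 (i0 := m j)) => [|i /uS ->]; last by rewrite normr0.
    rewrite normr_id /u eqxx -mulrA !normrM sg1 mulr1 (ger0_norm (w0 j)) mulrC.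
    by rewrite ler_wpM2r// -normrM tN.
  have [_ su _ ex] := rsum_exchange du.
  transitivity (rsum (fun j => rsum (u j))); last by apply: eq_rsum.
  rewrite ex; apply: eq_rsum => i; rewrite mulrC /c -rsumZ; last first.
    apply: (@asum_le _ _ _ (fun j => b i * w j)); last exact: asumZ.
    move=> j; rewrite !normrM sg1 mulr1 (ger0_norm (w0 j)) mulrC ler_wpM2r//.
    by case: ifP; rewrite ?normr0 ?ger0_norm.
  by apply: eq_rsum => j; rewrite /u mulrC.
(* The margin 1/4 is 3/4 for the main term minus 1/2 for the tail. *)
have low k : w k * N k / 4 <= K.
  apply: le_trans (HK (p k)); rewrite cT.
  have saw : asum (fun j => sg j * (w j * t k j)).
    apply: (@asum_le _ _ _ (fun j => N k * w j)); last exact: asumZ.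
    move=> j; rewrite !normrM sg1 mul1r (ger0_norm (w0 j)) mulrC ler_wpM2r//.
    by rewrite -normrM tN.
  have [tl1 tl2] := hump_weight_tail k.+1.
  have tl : `|rsum (fun j => if j \in index_iota 0 k.+1 then 0 else sg j * (w j * t k j))|
      <= N k * (w k / 2).
    apply: le_trans (ler_norm_rsum (v := fun j =>
      N k * (if (j < k.+1)%N then 0 else w j)) _ _) _; last 2 first.
    - exact: asumZ.
    - by rewrite rsumZ// ler_wpM2l.
    move=> j; rewrite mem_index_iota/=; case: ifP => _; first by rewrite normr0 mulr0.
    rewrite !normrM sg1 mul1r (ger0_norm (w0 j)) mulrC ler_wpM2r//.
    by rewrite -normrM tN.
  rewrite (@rsum_split _ _ _ (index_iota 0 k.+1)) ?iota_uniq//.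
  have := sgP k; rewrite normrM (ger0_norm (w0 k)).
  have := Hm k; have -> : b (m k) * `|T (p k) (m k)| = `|t k k|.
    by rewrite /t normrM (ger0_norm (b0 _)).
  set A := \sum_(0 <= j < k.+1) _ in tl *; set B := rsum _ in tl *.
  move=> h1 h2; have : `|A| <= `|A + B| + `|B|.
    by rewrite -{1}(addrK B A); exact: ler_normB.
  have : w k * (3 / 4 * N k) <= w k * `|t k k| by rewrite ler_wpM2l.
  by lra.
have lowk k : (4 / 3) ^+ k / 12 <= K.
  apply: le_trans (low k); have : w k * 4 ^+ k <= w k * N k by rewrite ler_wpM2l.
  have -> : w k * 4 ^+ k = (4 / 3) ^+ k / 3.
    by rewrite /w exprS [(4 / 3) ^+ k]exprMn; ring.
  lra.
have K0 : 0 <= K by apply: le_trans (lowk 0); rewrite expr0 divr_ge0.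
have := archi_boundP (_ : 0 <= 36 * K); rewrite mulr_ge0// => /(_ isT).
set k := Num.bound _; have := lowk k; have := bernoulli_43 k.
lra.
Qed.

End GlidingHump.

(** * Complex families, rapid decay and duality *)

Section ComplexNorm.
Context {R : realType}.
Implicit Types z : R[i].

Lemma normc_ge0 z : 0 <= normc z.
Proof. by case: z => a b; rewrite sqrtr_ge0. Qed.

Lemma normcE_sqr z : normc z ^+ 2 = complex.Re z ^+ 2 + complex.Im z ^+ 2.
Proof. by case: z => a b /=; rewrite sqr_sqrtr// addr_ge0 ?sqr_ge0. Qed.

Lemma ler_normr_sqr (x y : R) : 0 <= y -> x ^+ 2 <= y ^+ 2 -> `|x| <= y.
Proof.
by move=> y0; rewrite -[x ^+ 2]real_normK ?num_real// ler_sqr ?nnegrE.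
Qed.

Lemma normr_Re_le z : `|complex.Re z| <= normc z.
Proof.
apply: ler_normr_sqr; first exact: normc_ge0.
by rewrite normcE_sqr lerDl sqr_ge0.
Qed.

Lemma normr_Im_le z : `|complex.Im z| <= normc z.
Proof.
apply: ler_normr_sqr; first exact: normc_ge0.
by rewrite normcE_sqr lerDr sqr_ge0.
Qed.

Lemma normc_le_ReIm z : normc z <= `|complex.Re z| + `|complex.Im z|.
Proof.
rewrite -[normc z]ger0_norm ?normc_ge0//; apply: ler_normr_sqr.
  by rewrite addr_ge0.
rewrite normcE_sqr sqrrD !real_normK ?num_real// -addrA [_ *+ 2 + _]addrC addrA.
by rewrite lerDl mulrn_wge0// mulr_ge0.
Qed.

Lemma normc_triangle (x y : R[i]) : normc (x + y) <= normc x + normc y.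
Proof. exact: le_normcD. Qed.

Lemma normc_opp z : normc (- z) = normc z.
Proof. by case: z => a b /=; rewrite !sqrrN. Qed.

Lemma normc_conj z : normc z^*%C = normc z.
Proof. by case: z => a b /=; rewrite sqrrN. Qed.

Lemma ReD (x y : R[i]) : complex.Re (x + y) = complex.Re x + complex.Re y.
Proof. by case: x => ? ?; case: y. Qed.
Lemma ImD (x y : R[i]) : complex.Im (x + y) = complex.Im x + complex.Im y.
Proof. by case: x => ? ?; case: y. Qed.
Lemma ReM (x y : R[i]) :
  complex.Re (x * y) = complex.Re x * complex.Re y - complex.Im x * complex.Im y.
Proof. by case: x => ? ?; case: y. Qed.
Lemma ImM (x y : R[i]) :
  complex.Im (x * y) = complex.Re x * complex.Im y + complex.Im x * complex.Re y.
Proof. by case: x => ? ?; case: y. Qed.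
Lemma ReN z : complex.Re (- z) = - complex.Re z. Proof. by case: z. Qed.
Lemma complex_eqP (x y : R[i]) :
  complex.Re x = complex.Re y -> complex.Im x = complex.Im y -> x = y.
Proof. by case: x => ? ?; case: y => ? ? /= -> ->. Qed.

Lemma normc_real (x : R) : normc (x%:C)%C = `|x|.
Proof. by rewrite /= expr0n addr0 sqrtr_sqr. Qed.

End ComplexNorm.

Section ComplexSums.
Context {R : realType} {I : countType}.
Implicit Types w v : I -> R[i].

Definition casum w : Prop := asum (fun i => normc (w i)).

Definition csum w : R[i] :=
  Complex (rsum (fun i => complex.Re (w i))) (rsum (fun i => complex.Im (w i))).

Lemma casum_le w (v : I -> R) : (forall i, normc (w i) <= v i) -> asum v -> casum w.
Proof. by move=> wv; apply: asum_le => i; rewrite ger0_norm ?normc_ge0. Qed.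

Lemma casum_Re w : casum w -> asum (fun i => complex.Re (w i)).
Proof. by apply: asum_le => i; exact: normr_Re_le. Qed.

Lemma casum_Im w : casum w -> asum (fun i => complex.Im (w i)).
Proof. by apply: asum_le => i; exact: normr_Im_le. Qed.

Lemma casumZ (c : R[i]) w : casum w -> casum (fun i => c * w i).
Proof. by move=> /(asumZ (normc c)); apply: casum_le => i; rewrite normcM. Qed.

Lemma eq_csum w v : w =1 v -> csum w = csum v.
Proof. by move=> /funext ->. Qed.

Lemma csumD w v : casum w -> casum v -> csum (fun i => w i + v i) = csum w + csum v.
Proof.
move=> sw sv; apply: complex_eqP; rewrite (ReD, ImD) /=.
- by rewrite -rsumD; [apply: eq_rsum => i; rewrite ReD|exact: casum_Re|exact: casum_Re].
- by rewrite -rsumD; [apply: eq_rsum => i; rewrite ImD|exact: casum_Im|exact: casum_Im].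
Qed.

Lemma csumZ (c : R[i]) w : casum w -> csum (fun i => c * w i) = c * csum w.
Proof.
move=> sw; have := casum_Re sw; have := casum_Im sw => sI sR.
apply: complex_eqP; rewrite (ReM, ImM) /= -!rsumZ// -?rsumB -?rsumD;
  try by apply: asumZ.
- by apply: eq_rsum => i; rewrite ReM.
- by apply: eq_rsum => i; rewrite ImM.
Qed.

Lemma normc_csum w (v : I -> R) : (forall i, normc (w i) <= v i) -> asum v ->
  normc (csum w) <= 2 * rsum v.
Proof.
move=> wv sv; apply: le_trans (normc_le_ReIm _) _ => /=.
rewrite mulrDl mul1r lerD//; apply: ler_norm_rsum => // i; apply: le_trans (wv i).
- exact: normr_Re_le.
- exact: normr_Im_le.
Qed.

Lemma csum_supp1 w i0 : (forall i, i != i0 -> w i = 0) -> csum w = w i0.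
Proof.
move=> w0; apply: complex_eqP; rewrite /= (rsum_supp1 (i0 := i0))// => i /w0 ->//.
Qed.

Lemma casum_supp1 w i0 : (forall i, i != i0 -> w i = 0) -> casum w.
Proof. by move=> w0; apply: (@asum_supp1 _ _ _ i0) => i /w0 ->; exact: normc0. Qed.

Lemma csum_split w (s : seq I) : uniq s -> casum w ->
  csum w = \sum_(i <- s) w i + csum (fun i => if i \in s then 0 else w i).
Proof.
move=> us sw.
have ReS : complex.Re (\sum_(i <- s) w i) = \sum_(i <- s) complex.Re (w i).
  by elim: (s) => [|i s' IH]; rewrite ?big_nil ?big_cons ?ReD ?IH.
have ImS : complex.Im (\sum_(i <- s) w i) = \sum_(i <- s) complex.Im (w i).
  by elim: (s) => [|i s' IH]; rewrite ?big_nil ?big_cons ?ImD ?IH.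
apply: complex_eqP; rewrite (ReD, ImD) /= ?ReS ?ImS.
- rewrite (rsum_split us (casum_Re sw)); congr (_ + _).
  by apply: eq_rsum => i; case: ifP.
- rewrite (rsum_split us (casum_Im sw)); congr (_ + _).
  by apply: eq_rsum => i; case: ifP.
Qed.

End ComplexSums.

Lemma complex_gliding_hump {R : realType} (I : countType) (P : Type)
    (T : P -> I -> R[i]) (b : I -> R) :
  (forall i, 0 <= b i) ->
  (forall p, exists N : R, forall i, b i * normc (T p i) <= N) ->
  (forall c : I -> R, (forall i, `|c i| <= b i) ->
     exists K : R, forall p, normc (csum (fun i => (c i)%:C%C * T p i)) <= K) ->
  exists K : R, forall p i, b i * normc (T p i) <= K.
Proof.
move=> b0 bddP bddc.
have part (h : R[i] -> R) : (forall z, `|h z| <= normc z) ->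
    (forall w : I -> R[i], h (csum w) = rsum (fun i => h (w i))) ->
    (forall (x : R) z, h (x%:C%C * z) = x * h z) ->
    exists K : R, forall p i, b i * `|h (T p i)| <= K.
  move=> hn hsum hZ; apply: gliding_hump => //.
  - move=> p; have [N HN] := bddP p; exists N => i; apply: le_trans (HN i).
    by rewrite ler_wpM2l.
  - move=> c /bddc [K HK]; exists K => p; apply: le_trans (HK p).
    apply: le_trans (hn _); rewrite hsum.
    by under [X in _ <= `|X|]eq_rsum do rewrite hZ.
have [K1 H1] : exists K : R, forall p i, b i * `|complex.Re (T p i)| <= K.
  by apply: part => //; [exact: normr_Re_le|move=> x [u v] /=; rewrite mul0r subr0].
have [K2 H2] : exists K : R, forall p i, b i * `|complex.Im (T p i)| <= K.
  by apply: part => //; [exact: normr_Im_le|move=> x [u v] /=; rewrite mul0r addr0].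
exists (K1 + K2) => p i; apply: le_trans (lerD (H1 p i) (H2 p i)).
by rewrite -mulrDr ler_wpM2l// normc_le_ReIm.
Qed.

Section ComplexDoubleSums.
Context {R : realType} {I J : countType}.

Lemma csum_exchange (u : I -> J -> R[i]) : dsum (fun i j => normc (u i j)) ->
  [/\ forall i, casum (u i), casum (fun i => csum (u i)),
      forall j, casum (u^~ j), casum (fun j => csum (u^~ j)) &
      csum (fun i => csum (u i)) = csum (fun j => csum (u^~ j))].
Proof.
move=> su.
have sub (f : R[i] -> R) : (forall z, `|f z| <= normc z) -> dsum (fun i j => f (u i j)).
  move=> fn; apply: le_lt_trans su; apply: le_esum => i _; apply: le_esum => j _.
  by rewrite lee_fin (le_trans (fn _))// ler_norm.
have [s1 s2 s3 s4] := rsum_exchange (sub _ normr_Re_le).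
have [t1 t2 t3 t4] := rsum_exchange (sub _ normr_Im_le).
have [n1 n2 n3 n4] := rsum_exchange su.
have lec (K : countType) (w : K -> R[i]) : asum (fun k => complex.Re (w k)) ->
    asum (fun k => complex.Im (w k)) -> casum w.
  move=> a b; apply: casum_le (asumD (asum_norm a) (asum_norm b)) => k.
  exact: normc_le_ReIm.
split.
- by move=> i; exact: (dsum_asum i su).
- exact: (lec _ (fun i => csum (u i)) s1 t1).
- by move=> j; exact: n2.
- exact: (lec _ (fun j => csum (u^~ j)) s3 t3).
- by apply: complex_eqP.
Qed.

End ComplexDoubleSums.

Section Dual.
Context {R : realType} {I : countType}.
Implicit Types (V : set (I -> R[i])) (v a : I -> R[i]).

Lemma pairingE v a : pairing v a = csum (fun i => v i * a i).
Proof. by []. Qed.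

Lemma pairingC v a : pairing v a = pairing a v.
Proof. by rewrite !pairingE; apply: eq_csum => i; rewrite mulrC. Qed.

Lemma alpha_dualP V a : alpha_dual V a <-> forall v, V v -> casum (fun i => v i * a i).
Proof.
by split=> h v /h; rewrite /casum /asum; congr (_ < _)%E; apply: eq_esum => i _;
  rewrite normcM ger0_norm// mulr_ge0 ?normc_ge0.
Qed.

Lemma alpha_dual_bidual V v : V v -> alpha_dual (alpha_dual V) v.
Proof.
move=> Vv; apply/alpha_dualP => a /alpha_dualP /(_ _ Vv).
by under eq_fun do rewrite mulrC.
Qed.

End Dual.

Lemma powR_cancel {R : realType} (x t : R) : 0 < x -> x `^ (- t) * x `^ t = 1.
Proof. by move=> x0; rewrite -powRD ?addNr ?powRr0//; apply/implyP => _; rewrite gt_eqF. Qed.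

Section WeightedSequences.
Context {R : realType} {I : countType}.
Variables (L : I -> R) (s0 : R).
Hypothesis L0 : forall i, 0 < L i.
Hypothesis sumL : asum (fun i => L i `^ (- s0)).
Implicit Types (c v a : I -> R[i]).

Definition rapid : set (I -> R[i]) :=
  [set c | forall s : R, asum (fun i => normc (c i) * L i `^ s)].

Let LD i x y : L i `^ (x + y) = L i `^ x * L i `^ y.
Proof. by rewrite powRD//; apply/implyP => _; rewrite gt_eqF. Qed.

Lemma rapid_asum c : rapid c -> asum (fun i => normc (c i)).
Proof. by move=> /(_ 0); apply: asum_le => i; rewrite powRr0 mulr1 ger0_norm ?normc_ge0. Qed.

Lemma rapid_le c c' (K : R) : (forall i, normc (c' i) <= K * normc (c i)) ->
  rapid c -> rapid c'.
Proof.
move=> cc cr s; apply: asum_le (asumZ K (cr s)) => i.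
by rewrite ger0_norm ?mulr_ge0 ?normc_ge0 ?powR_ge0// mulrA ler_wpM2r ?powR_ge0.
Qed.

Lemma rapid_weight c (t : R) : rapid c -> rapid (fun i => (L i `^ t)%:C%C * c i).
Proof.
move=> cr s; apply: asum_le (cr (t + s)) => i.
rewrite ger0_norm ?mulr_ge0 ?normc_ge0 ?powR_ge0// normcM normc_real.
by rewrite ger0_norm ?powR_ge0// LD mulrCA mulrA.
Qed.

(** In the quadratic form of the decay condition a loss of [s0] in the exponent
    pays for the passage from l^2 to l^1. *)
Lemma rapid_sqr c :
  rapid c <-> forall s : R, asum (fun i => L i `^ (2 * s) * normc (c i) ^+ 2).
Proof.
split=> [cr s|c2 s].
  have sS := cr s; pose S := rsum (fun i => `|normc (c i) * L i `^ s|).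
  apply: asum_le (asumZ S sS) => i.
  have h0 : 0 <= normc (c i) * L i `^ s by rewrite mulr_ge0 ?normc_ge0 ?powR_ge0.
  have -> : L i `^ (2 * s) * normc (c i) ^+ 2 = (normc (c i) * L i `^ s) ^+ 2.
    by rewrite mulrDl mul1r LD; ring.
  rewrite ger0_norm ?sqr_ge0// expr2 ler_wpM2r//.
  by have := asum_coef i sS; rewrite ger0_norm.
apply: asum_le (asumD (c2 (s + s0 / 2)) sumL) => i.
rewrite ger0_norm ?mulr_ge0 ?normc_ge0 ?powR_ge0//.
have -> : L i `^ (- s0) = (L i `^ (- (s0 / 2))) ^+ 2.
  by rewrite expr2 -LD; congr (_ `^ _); lra.
have -> : L i `^ (2 * (s + s0 / 2)) = (L i `^ (s + s0 / 2)) ^+ 2.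
  by rewrite expr2 -LD; congr (_ `^ _); lra.
have -> : normc (c i) * L i `^ s =
    (L i `^ (s + s0 / 2) * normc (c i)) * L i `^ (- (s0 / 2)).
  by rewrite LD -[LHS]mulr1 -[X in _ * X = _](powR_cancel (s0 / 2) (L0 i)); ring.
rewrite -exprMn; set x := _ * normc _; set y := L i `^ _.
have : 0 <= (x - y) ^+ 2 by rewrite sqr_ge0.
have : 0 <= x * y by rewrite !mulr_ge0 ?normc_ge0 ?powR_ge0.
by nra.
Qed.

Lemma dual_weight a (t : R) : alpha_dual rapid a ->
  alpha_dual rapid (fun i => (L i `^ t)%:C%C * a i).
Proof.
move=> /alpha_dualP da; apply/alpha_dualP => v /(@rapid_weight _ t) /da.
by under eq_fun do rewrite mulrAC mulrC.
Qed.

Lemma dual_power (t : R) : alpha_dual rapid (fun i => (L i `^ t)%:C%C).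
Proof.
apply/alpha_dualP => v /(_ t); apply: asum_le => i.
by rewrite ger0_norm ?normc_ge0// normcM normc_real ger0_norm ?powR_ge0.
Qed.

(** The powers of the weight belong to the dual, and pairing with them already
    expresses rapid decay. *)
Lemma rapid_perfect u : alpha_dual (alpha_dual rapid) u -> rapid u.
Proof.
move=> /alpha_dualP du s; have := du _ (dual_power s); apply: asum_le => i.
rewrite normcM normc_real ger0_norm ?mulr_ge0 ?normc_ge0 ?powR_ge0// mulrC.
by rewrite ger0_norm ?powR_ge0.
Qed.

Lemma rapid_unit (i0 : I) : rapid (fun i => (i == i0)%:R).
Proof.
move=> s; apply: (@asum_supp1 _ _ _ i0) => i /negPf ->.
by rewrite normc0 mul0r.
Qed.

Lemma dual_unit (V : set (I -> R[i])) (i0 : I) : alpha_dual V (fun i => (i == i0)%:R).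
Proof.
apply/alpha_dualP => v _; apply: (@casum_supp1 _ _ _ i0) => i /negPf ->.
by rewrite mulr0.
Qed.

Lemma pairing_unit v (i0 : I) : pairing v (fun i => (i == i0)%:R) = v i0.
Proof.
rewrite pairingE (csum_supp1 (i0 := i0)) ?eqxx ?mulr1// => i /negPf ->.
by rewrite mulr0.
Qed.

End WeightedSequences.

Section SpectralWeights.
Context {R : realType}.
Variables (d : nat -> nat) (lam : nat -> R).

Definition spec_weight (i : idx d) : R := lam (tag i).

(** The index set is the disjoint union of the finite blocks of fixed [j]. *)
Lemma esum_idx (a : idx d -> \bar R) : (forall i, (0 <= a i)%E) ->
  (\esum_(i in [set: idx d]) a i = \sum_(0 <= j <oo) \sum_(l < d j) a (mkidx l))%E.
Proof.
move=> a0; pose J k := [set i : idx d | tag i = k].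
have UJ : [set: idx d] = \bigcup_(k in [set: nat]) J k.
  by apply/seteqP; split=> // i _; exists (tag i).
rewrite UJ esum_bigcupT//; last by move=> k k' _ _ [i [/= <- <-]].
rewrite nneseries_esumT; last by move=> j; exact: sume_ge0.
apply: eq_esum => j _.
transitivity (\esum_(l in [set: 'I_(d j)]) a (mkidx l))%E.
  apply: reindex_esum; split=> //=.
  - move=> l l' _ _ /eqP; rewrite -tag_eqE /tag_eq eqxx/= tagged_asE.
    by move=> /eqP.
  - by move=> [k l] /= kj; rewrite /J/= in kj; subst k; exists l.
transitivity (\esum_(l in [set: 'I_(d j)])
    \sum_(l' < d j) if l' == l then a (mkidx l') else 0)%E.
  by apply: eq_esum => l _; rewrite -big_mkcond/= big_pred1_eq.
rewrite esum_sum; last by move=> l l' _ _; case: ifP.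
apply: eq_bigr => l _; rewrite (esumID [set l]); last by move=> l' _; case: ifP.
rewrite setTI esum_set1 ?eqxx// esum1 ?adde0// => l' [_ /eqP].
by rewrite eq_sym => /negPf ->.
Qed.

Lemma rapid_decayP (c : idx d -> R[i]) :
  rapid_decay lam c <->
  forall s : R, asum (fun i => spec_weight i `^ (2 * s) * normc (c i) ^+ 2).
Proof.
suff E s : (\sum_(0 <= j <oo) (lam j `^ (2 * s) *
      \sum_(l < d j) normc (c (mkidx l)) ^+ 2)%:E =
    \esum_(i in [set: idx d]) (`|spec_weight i `^ (2 * s) * normc (c i) ^+ 2|)%:E)%E.
  by split=> h s; move: (h s); rewrite /asum E.
rewrite esum_idx//; apply: eq_eseriesr => j _.
rewrite mulr_sumr -sumEFin; apply: eq_bigr => l _.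
by rewrite ger0_norm// mulr_ge0 ?sqr_ge0 ?powR_ge0.
Qed.

Lemma spectral_weight_pos i : spectral_data d lam -> 0 < spec_weight i.
Proof. by case=> _ lam0 _ _; exact: lam0. Qed.

Lemma spectral_weight_asum : spectral_data d lam ->
  exists s0 : R, asum (fun i : idx d => spec_weight i `^ (- s0)).
Proof.
move=> [_ _ _ [s0 _ h]]; exists s0; move: h; rewrite /asum; congr (_ < _)%E.
rewrite esum_idx//; apply: eq_eseriesr => j _.
rewrite sumEFin (eq_bigr (fun=> lam j `^ (- s0))); last first.
  by move=> l _; rewrite ger0_norm ?powR_ge0.
by rewrite sumr_const card_ord mulr_natl.
Qed.

Lemma rapid_decay_rapid (c : idx d -> R[i]) : spectral_data d lam ->
  rapid_decay lam c <-> rapid spec_weight c.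
Proof.
move=> dl; have [s0 hs0] := spectral_weight_asum dl.
rewrite rapid_decayP; apply: iff_sym; apply: rapid_sqr hs0 c => i.
exact: spectral_weight_pos.
Qed.

End SpectralWeights.

(** * Integration of sums *)

Section EsumIntegral.
Context {R : realType} {I : countType}.

(** Enumerating the index set by [pickle_inv], with 0 where it is undefined,
    makes monotone convergence available for sums over [I]. *)
Lemma esum_count (a : I -> \bar R) : (forall i, (0 <= a i)%E) ->
  (\esum_(i in [set: I]) a i =
   \sum_(0 <= n <oo) oapp a 0%E (pickle_inv n : option I))%E.
Proof.
move=> a0; rewrite nneseries_esumT; last by move=> n; case: (pickle_inv n).
have injp : set_inj [set: I] (@pickle I) by move=> x y _ _ /(pcan_inj pickleK).
transitivity (\esum_(n in @pickle I @` [set: I]) oapp a 0%E (pickle_inv n : option I))%E.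
  rewrite esum_image//; apply: eq_esum => i _.
  by rewrite pickleK_inv.
rewrite esum_mkcond; apply: eq_esum => n _; case: ifPn => //.
rewrite notin_setE => nr; case E : (pickle_inv n : option I) => [i|]//=.
exfalso; apply: nr; exists i => //.
have := @pickle_invK I n; rewrite /ocancel/= E/=.
exact.
Qed.

Context d (T : measurableType d) (mu : {measure set T -> \bar R}).

Lemma measurable_esum (f : I -> T -> \bar R) :
  (forall i, measurable_fun setT (f i)) -> (forall i x, (0 <= f i x)%E) ->
  measurable_fun setT (fun x => \esum_(i in [set: I]) f i x)%E.
Proof.
move=> mf f0; under eq_fun do rewrite esum_count//.
apply: (@ge0_emeasurable_sum _ _ _ _ (fun n x => oapp (f^~ x) 0%E (pickle_inv n : option I)) xpredT) => //.
- by move=> n x _ _; case: (pickle_inv n) => /=.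
- by move=> n _; case: (pickle_inv n : option I) => [i|]/=; [exact: mf|exact: measurable_cst].
Qed.

Lemma integral_esum (f : I -> T -> \bar R) :
  (forall i, measurable_fun setT (f i)) -> (forall i x, (0 <= f i x)%E) ->
  (\int[mu]_x (\esum_(i in [set: I]) f i x) = \esum_(i in [set: I]) \int[mu]_x f i x)%E.
Proof.
move=> mf f0; under eq_integral do rewrite esum_count//.
rewrite esum_count; last by move=> i; exact: integral_ge0.
rewrite integral_nneseries//.
- apply: eq_eseriesr => n _; case: (pickle_inv n : option I) => [i|]//=.
  by rewrite integral0.
- by move=> n; case: (pickle_inv n : option I) => [i|]/=; [exact: mf|exact: measurable_cst].
- by move=> n x _; case: (pickle_inv n) => /=.
Qed.

(** An integrable function is infinite on a null set only, and there [fine]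
    replaces it by 0. *)
Lemma integrable_fine (F : T -> \bar R) : (forall x, (0 <= F x)%E) ->
  measurable_fun setT F -> (\int[mu]_x F x < +oo)%E ->
  mu.-integrable setT (EFin \o (fine \o F)) /\
  (\int[mu]_x (fine (F x))%:E = \int[mu]_x F x)%E.
Proof.
move=> F0 mF Foo.
have iF : mu.-integrable setT F.
  apply/integrableP; split=> //.
  by under eq_integral do rewrite gee0_abs//.
have mfF : measurable_fun setT (EFin \o (fine \o F)).
  by apply/measurable_EFinP; exact: measurableT_comp.
split.
  apply: le_integrable mfF _ iF => // x _ /=.
  by case: (F x) (F0 x) => [r||]//= _; rewrite normr0 leey.
apply: ae_eq_integral => //.
have := integrable_ae measurableT iF.
by apply: filterS => x /(_ Logic.I) Fx _ /=; rewrite fineK.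
Qed.

(** Positive and negative parts are summed separately.  The pointwise sum may
    diverge on a null set, where [rsum] has an arbitrary but measurable value. *)
Lemma Rintegral_rsum (u : I -> T -> R) :
  (forall i, measurable_fun setT (u i)) ->
  (\esum_(i in [set: I]) \int[mu]_x (`|u i x|)%:E < +oo)%E ->
  [/\ mu.-integrable setT (EFin \o (fun x => rsum (u^~ x))),
      asum (fun i => \int[mu]_x u i x) &
      \int[mu]_x rsum (u^~ x) = rsum (fun i => \int[mu]_x u i x)].
Proof.
move=> mu_ sumu.
pose p i x := ((EFin \o u i)^\+ x)%E; pose q i x := ((EFin \o u i)^\- x)%E.
have mEu i : measurable_fun setT (EFin \o u i) by exact/measurable_EFinP.
have mp i : measurable_fun setT (p i) by exact: measurable_funepos.
have mq i : measurable_fun setT (q i) by exact: measurable_funeneg.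
have p0 i x : (0 <= p i x)%E by exact: funepos_ge0.
have q0 i x : (0 <= q i x)%E by exact: funeneg_ge0.
have mabs i : measurable_fun setT (fun x => (`|u i x|)%:E).
  by apply/measurable_EFinP; exact: measurableT_comp.
have ple i x : (p i x <= (`|u i x|)%:E)%E.
  by rewrite /p funeposE/= ge_max !lee_fin normr_ge0 andbT ler_norm.
have qle i x : (q i x <= (`|u i x|)%:E)%E.
  by rewrite /q funenegE/= ge_max !lee_fin normr_ge0 andbT -normrN ler_norm.
have ip i : (\int[mu]_x p i x <= \int[mu]_x (`|u i x|)%:E)%E by exact: ge0_le_integral.
have iq i : (\int[mu]_x q i x <= \int[mu]_x (`|u i x|)%:E)%E by exact: ge0_le_integral.
have sp : (\esum_(i in [set: I]) \int[mu]_x p i x < +oo)%E.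
  by apply: le_lt_trans sumu; apply: le_esum.
have sq : (\esum_(i in [set: I]) \int[mu]_x q i x < +oo)%E.
  by apply: le_lt_trans sumu; apply: le_esum.
have fin_term (r : I -> \bar R) i : (forall i, (0 <= r i)%E) ->
    (\esum_(i in [set: I]) r i < +oo)%E -> r i \is a fin_num.
  move=> r0 h; rewrite ge0_fin_numE//; apply: le_lt_trans h.
  by apply: esum_ge; exists [set i]; rewrite ?fsbig_set1.
have fp i : (\int[mu]_x p i x)%E \is a fin_num.
  by apply: (fin_term (fun i => \int[mu]_x p i x)%E) => // j; exact: integral_ge0.
have fq i : (\int[mu]_x q i x)%E \is a fin_num.
  by apply: (fin_term (fun i => \int[mu]_x q i x)%E) => // j; exact: integral_ge0.
have [P1 P2] : mu.-integrable setT (EFin \o (fine \o (fun x => \esum_(i in [set: I]) p i x))%E)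
    /\ (\int[mu]_x (fine (\esum_(i in [set: I]) p i x))%:E =
        \int[mu]_x (\esum_(i in [set: I]) p i x))%E.
  apply: integrable_fine; [by move=> x; exact: esum_ge0|exact: measurable_esum|].
  by rewrite integral_esum.
have [Q1 Q2] : mu.-integrable setT (EFin \o (fine \o (fun x => \esum_(i in [set: I]) q i x))%E)
    /\ (\int[mu]_x (fine (\esum_(i in [set: I]) q i x))%:E =
        \int[mu]_x (\esum_(i in [set: I]) q i x))%E.
  apply: integrable_fine; [by move=> x; exact: esum_ge0|exact: measurable_esum|].
  by rewrite integral_esum.
rewrite integral_esum// in P2; rewrite integral_esum// in Q2.
pose ap i := fine (\int[mu]_x p i x)%E; pose aq i := fine (\int[mu]_x q i x)%E.
have ap0 i : 0 <= ap i by rewrite fine_ge0// integral_ge0.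
have aq0 i : 0 <= aq i by rewrite fine_ge0// integral_ge0.
have sap : asum ap.
  by rewrite /asum; under eq_esum do rewrite ger0_norm// fineK//.
have saq : asum aq.
  by rewrite /asum; under eq_esum do rewrite ger0_norm// fineK//.
have uE i : \int[mu]_x u i x = ap i - aq i.
  by rewrite /Rintegral integralE fineB; [|exact: fp|exact: fq].
have rE x : rsum (u^~ x) =
    fine (\esum_(i in [set: I]) p i x) - fine (\esum_(i in [set: I]) q i x).
  by rewrite /rsum; congr (fine _ - fine _); apply: eq_esum => i _;
    rewrite /p /q ?funeposE ?funenegE.
split.
- by apply: (eq_integrable measurableT _ _ _ (integrableB measurableT P1 Q1)) => x _ /=; rewrite rE.
- rewrite (_ : (fun _ => _) = (fun i => ap i - aq i)); first exact: asumB.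
  by apply/funext => i; exact: uE.
- rewrite (eq_rsum uE) rsum_ge0B//; under eq_Rintegral do rewrite rE.
  rewrite (RintegralB measurableT P1 Q1).
  rewrite /Rintegral/= P2 Q2 !rsum_ge0E//.
  by congr (fine _ - fine _); apply: eq_esum => i _; rewrite fineK.
Qed.

End EsumIntegral.

Section ComplexIntegral.
Context {R : realType} d (T : measurableType d) (mu : {measure set T -> \bar R}).
Implicit Types f g : T -> R[i].

Definition cmeasurable f : Prop :=
  measurable_fun setT (fun x => complex.Re (f x)) /\
  measurable_fun setT (fun x => complex.Im (f x)).

Definition cintegrable f : Prop :=
  cmeasurable f /\ (\int[mu]_x (normc (f x))%:E < +oo)%E.

Definition cint f : R[i] :=
  Complex (\int[mu]_x complex.Re (f x)) (\int[mu]_x complex.Im (f x)).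

Lemma cmeasurableD f g : cmeasurable f -> cmeasurable g -> cmeasurable (fun x => f x + g x).
Proof.
move=> [f1 f2] [g1 g2]; split.
- by under eq_fun do rewrite ReD; exact: measurable_funD.
- by under eq_fun do rewrite ImD; exact: measurable_funD.
Qed.

Lemma cmeasurableM f g : cmeasurable f -> cmeasurable g -> cmeasurable (fun x => f x * g x).
Proof.
move=> [f1 f2] [g1 g2]; split.
- by under eq_fun do rewrite ReM; apply: measurable_funB; exact: measurable_funM.
- by under eq_fun do rewrite ImM; apply: measurable_funD; exact: measurable_funM.
Qed.

Lemma cmeasurable_cst (c : R[i]) : cmeasurable (fun=> c).
Proof. by split; exact: measurable_cst. Qed.

Lemma cmeasurable_conj f : cmeasurable f -> cmeasurable (fun x => (f x)^*%C).
Proof.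
move=> [f1 f2]; split.
- by rewrite (_ : (fun _ => _) = (fun x => complex.Re (f x)))//; apply/funext => x; case: (f x).
- rewrite (_ : (fun _ => _) = (fun x => - complex.Im (f x))); first exact: measurable_funN.
  by apply/funext => x; case: (f x).
Qed.

Lemma measurable_sqr_normc f : cmeasurable f ->
  measurable_fun setT (fun x => normc (f x) ^+ 2).
Proof.
move=> [f1 f2]; under eq_fun do rewrite normcE_sqr.
by apply: measurable_funD; exact: measurable_funX.
Qed.

Lemma measurable_normc f : cmeasurable f -> measurable_fun setT (fun x => normc (f x)).
Proof.
move=> /measurable_sqr_normc mf.
have -> : (fun x => normc (f x)) = (fun x => (normc (f x) ^+ 2) `^ 2^-1).
  apply/funext => x; rewrite -powR_mulrn ?normc_ge0// -powRrM mulfV// powRr1//.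
  exact: normc_ge0.
exact: (measurableT_comp (measurable_powR _) mf).
Qed.

Lemma cintegrable_le f (h : T -> \bar R) : cmeasurable f -> measurable_fun setT h ->
  (forall x, ((normc (f x))%:E <= h x)%E) -> (\int[mu]_x h x < +oo)%E -> cintegrable f.
Proof.
move=> mf mh fh hoo; split=> //; apply: le_lt_trans hoo; apply: ge0_le_integral => //.
- by move=> x _; rewrite lee_fin normc_ge0.
- by apply/measurable_EFinP; exact: measurable_normc.
Qed.

Lemma cintegrable_Re f : cintegrable f ->
  mu.-integrable setT (EFin \o (fun x => complex.Re (f x))).
Proof.
move=> [mf fi]; have [f1 f2] := mf; apply/integrableP; split; first exact/measurable_EFinP.
apply: le_lt_trans fi; apply: ge0_le_integral => //.
- by apply: measurableT_comp => //; exact/measurable_EFinP.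
- by apply/measurable_EFinP; exact: measurable_normc.
- by move=> x _ /=; rewrite lee_fin normr_Re_le.
Qed.

Lemma cintegrable_Im f : cintegrable f ->
  mu.-integrable setT (EFin \o (fun x => complex.Im (f x))).
Proof.
move=> [mf fi]; have [f1 f2] := mf; apply/integrableP; split; first exact/measurable_EFinP.
apply: le_lt_trans fi; apply: ge0_le_integral => //.
- by apply: measurableT_comp => //; exact/measurable_EFinP.
- by apply/measurable_EFinP; exact: measurable_normc.
- by move=> x _ /=; rewrite lee_fin normr_Im_le.
Qed.

Lemma cintegrableD f g : cintegrable f -> cintegrable g -> cintegrable (fun x => f x + g x).
Proof.
move=> [mf fi] [mg gi].
apply: (@cintegrable_le _ (fun x => (normc (f x))%:E + (normc (g x))%:E)%E).
- exact: cmeasurableD.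
- by apply: emeasurable_funD; apply/measurable_EFinP; exact: measurable_normc.
- by move=> x; rewrite -EFinD lee_fin normc_triangle.
- rewrite ge0_integralD//; first exact: lte_add_pinfty.
  + by move=> x _; rewrite lee_fin normc_ge0.
  + by apply/measurable_EFinP; exact: measurable_normc.
  + by move=> x _; rewrite lee_fin normc_ge0.
  + by apply/measurable_EFinP; exact: measurable_normc.
Qed.

Lemma cintegrableZ (c : R[i]) f : cintegrable f -> cintegrable (fun x => c * f x).
Proof.
move=> [mf fi].
apply: (@cintegrable_le _ (fun x => (normc c)%:E * (normc (f x))%:E)%E).
- by apply: cmeasurableM => //; exact: cmeasurable_cst.
- apply: emeasurable_funM; first exact: measurable_cst.
  by apply/measurable_EFinP; exact: measurable_normc.
- by move=> x; rewrite -EFinM lee_fin normcM.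
- rewrite ge0_integralZl_EFin ?normc_ge0//.
  + by rewrite lte_mul_pinfty ?lee_fin ?normc_ge0.
  + by move=> x _; rewrite lee_fin normc_ge0.
  + by apply/measurable_EFinP; exact: measurable_normc.
Qed.

Lemma cintD f g : cintegrable f -> cintegrable g -> cint (fun x => f x + g x) = cint f + cint g.
Proof.
move=> fi gi; apply: complex_eqP; rewrite (ReD, ImD)/=.
- under eq_Rintegral do rewrite ReD.
  by rewrite RintegralD//; exact: cintegrable_Re.
- under eq_Rintegral do rewrite ImD.
  by rewrite RintegralD//; exact: cintegrable_Im.
Qed.

Lemma cintZ (c : R[i]) f : cintegrable f -> cint (fun x => c * f x) = c * cint f.
Proof.
move=> fi; have fR := cintegrable_Re fi; have fI := cintegrable_Im fi.
have ZR (k : R) h : mu.-integrable setT (EFin \o h) ->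
    mu.-integrable setT (EFin \o (fun x => k * h x)).
  by move=> hi; have := integrableZl measurableT k hi.
apply: complex_eqP; rewrite (ReM, ImM)/=.
- under eq_Rintegral do rewrite ReM.
  by rewrite RintegralB ?RintegralZl//; exact: ZR.
- under eq_Rintegral do rewrite ImM.
  by rewrite RintegralD ?RintegralZl//; exact: ZR.
Qed.

Lemma normc_cint f (K : R) : cintegrable f ->
  (\int[mu]_x (normc (f x))%:E <= K%:E)%E -> normc (cint f) <= 2 * K.
Proof.
move=> fi fK; have [mf fi'] := fi; have mn := measurable_normc mf.
have bnd (h : R[i] -> R) : (forall z, `|h z| <= normc z) ->
    mu.-integrable setT (EFin \o (fun x => h (f x))) -> `|\int[mu]_x h (f x)| <= K.
  move=> hn hi; rewrite -lee_fin EFin_normr_Rintegral//.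
  have mh : measurable_fun setT (EFin \o (fun x => h (f x))) by exact: measurable_int hi.
  apply: le_trans (le_abse_integral mu measurableT mh) _.
  apply: le_trans fK; apply: ge0_le_integral => //.
  - exact: measurableT_comp.
  - exact/measurable_EFinP.
  - by move=> x _ /=; rewrite lee_fin.
apply: le_trans (normc_le_ReIm _) _; rewrite mulrDl mul1r/= lerD//.
- by apply: bnd; [exact: normr_Re_le|exact: cintegrable_Re].
- by apply: bnd; [exact: normr_Im_le|exact: cintegrable_Im].
Qed.

Lemma eq_cint f g : f =1 g -> cint f = cint g.
Proof. by move=> /funext ->. Qed.

Lemma ae_eq_cint f g : cmeasurable f -> cmeasurable g ->
  {ae mu, forall x, f x = g x} -> cint f = cint g.
Proof.
move=> [f1 f2] [g1 g2] fg; congr Complex; congr fine; apply: ae_eq_integral => //;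
  try (exact/measurable_EFinP); apply: filterS fg => x fgx _ /=; by rewrite fgx.
Qed.

Lemma cint_sum (J : Type) (s : seq J) (f : J -> T -> R[i]) :
  (forall j, cintegrable (f j)) ->
  cintegrable (fun x => \sum_(j <- s) f j x) /\
  cint (fun x => \sum_(j <- s) f j x) = \sum_(j <- s) cint (f j).
Proof.
move=> fi; elim: s => [|j s [IHi IHe]].
  under eq_fun do rewrite big_nil; rewrite big_nil; split.
    split; first exact: cmeasurable_cst.
    by under eq_integral do rewrite normc0; rewrite integral0 ltry.
  by rewrite /cint/= /Rintegral integral0.
under eq_fun do rewrite big_cons; rewrite big_cons; split; first exact: cintegrableD.
by rewrite cintD// IHe.
Qed.

Lemma cint_csum (I : countType) (w : I -> T -> R[i]) :
  (forall i, cmeasurable (w i)) ->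
  (\esum_(i in [set: I]) \int[mu]_x (normc (w i x))%:E < +oo)%E ->
  [/\ cmeasurable (fun x => csum (w^~ x)), casum (fun i => cint (w i)) &
      cint (fun x => csum (w^~ x)) = csum (fun i => cint (w i))].
Proof.
move=> mw sw.
have part (h : R[i] -> R) : (forall z, `|h z| <= normc z) ->
    (forall i, measurable_fun setT (fun x => h (w i x))) ->
  [/\ mu.-integrable setT (EFin \o (fun x => rsum (fun i => h (w i x)))),
      asum (fun i => \int[mu]_x h (w i x)) &
      \int[mu]_x rsum (fun i => h (w i x)) = rsum (fun i => \int[mu]_x h (w i x))].
  move=> hn mh; apply: (Rintegral_rsum (u := fun i x => h (w i x))) => //.
  apply: le_lt_trans sw; apply: le_esum => i _; apply: ge0_le_integral => //.
  - by apply/measurable_EFinP; exact: measurableT_comp.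
  - by apply/measurable_EFinP; exact: measurable_normc.
  - by move=> x _; rewrite lee_fin.
have [r1 r2 r3] := part _ normr_Re_le (fun i => (mw i).1).
have [m1 m2 m3] := part _ normr_Im_le (fun i => (mw i).2).
split.
- by split; apply/measurable_EFinP; [exact: measurable_int r1|exact: measurable_int m1].
- apply: casum_le (asumD (asum_norm r2) (asum_norm m2)) => i.
  exact: normc_le_ReIm.
- by apply: complex_eqP.
Qed.

End ComplexIntegral.

(** * Square integrable functions *)

Section L2Theory.
Context {R : realType} {X : ptopologicalType}.
Variable mu : {measure set (borel X) -> \bar R}.
Implicit Types f g : X -> R[i].

Local Notation meas f := (cmeasurable (T := borel X) f).
Local Notation N2 f := (fun x : borel X => (normc (f x) ^+ 2)%:E).

Lemma L2_meas f : L2 mu f -> meas f.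
Proof. by case. Qed.

Lemma sqnorm_ge0 f : (0 <= sqnormL2 mu f)%E.
Proof. by apply: integral_ge0 => x _; rewrite lee_fin sqr_ge0. Qed.

Lemma measurable_N2 f : meas f -> measurable_fun setT (N2 f).
Proof. by move=> mf; apply/measurable_EFinP; exact: measurable_sqr_normc. Qed.

Lemma mulr_le_sqr (x y : R) : 0 <= x -> 0 <= y -> x * y <= x ^+ 2 + y ^+ 2.
Proof. by move=> x0 y0; have := sqr_ge0 (x - y); have := mulr_ge0 x0 y0; nra. Qed.

Lemma L2_le f (h : borel X -> \bar R) : meas f -> measurable_fun setT h ->
  {ae mu, forall x, (N2 f x <= h x)%E} -> (forall x, (0 <= h x)%E) ->
  (\int[mu]_x h x < +oo)%E -> L2 mu f.
Proof.
move=> mf mh fh h0 hoo; have [f1 f2] := mf; split=> //.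
apply: le_lt_trans hoo; apply: ae_ge0_le_integral => //.
- by move=> x _; rewrite lee_fin sqr_ge0.
- exact: measurable_N2.
- by apply: filterS fh => x h' _.
Qed.

Lemma L2D f g : L2 mu f -> L2 mu g -> L2 mu (fun x => f x + g x).
Proof.
move=> f2 g2; have mf := L2_meas f2; have mg := L2_meas g2.
have m2 : measurable_fun setT (fun x => 2%:E * N2 f x + 2%:E * N2 g x)%E.
  by apply: emeasurable_funD; apply: emeasurable_funM; rewrite ?measurable_cst//; exact: measurable_N2.
apply: L2_le m2 _ _ _; first exact: cmeasurableD.
- apply: aeW => x; rewrite -!EFinM -EFinD lee_fin.
  have := normc_triangle (f x) (g x); have := normc_ge0 (f x + g x).
  have := normc_ge0 (f x); have := normc_ge0 (g x).
  set a := normc (f x); set b := normc (g x); set c := normc _ => b0 a0 c0 cab.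
  have := sqr_ge0 (a - b); nra.
- by move=> x; rewrite -!EFinM -EFinD lee_fin addr_ge0// mulr_ge0// sqr_ge0.
- rewrite ge0_integralD//; last 4 first.
  + by move=> x _; rewrite -EFinM lee_fin mulr_ge0// sqr_ge0.
  + by apply: emeasurable_funM; rewrite ?measurable_cst//; exact: measurable_N2.
  + by move=> x _; rewrite -EFinM lee_fin mulr_ge0// sqr_ge0.
  + by apply: emeasurable_funM; rewrite ?measurable_cst//; exact: measurable_N2.
  have sq (h : X -> R[i]) : L2 mu h -> (\int[mu]_x (2%:E * N2 h x) < +oo)%E.
    move=> [h1 h2 h3]; rewrite ge0_integralZl_EFin//.
    + by rewrite lte_mul_pinfty.
    + by move=> x _; rewrite lee_fin sqr_ge0.
    + exact: measurable_N2.
  by apply: lte_add_pinfty; exact: sq.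
Qed.

Lemma L2Z (c : R[i]) f : L2 mu f -> L2 mu (fun x => c * f x).
Proof.
move=> f2; have mf := L2_meas f2.
have m2 : measurable_fun setT (fun x => (normc c ^+ 2)%:E * N2 f x)%E.
  by apply: emeasurable_funM; rewrite ?measurable_cst//; exact: measurable_N2.
apply: L2_le m2 _ _ _.
- by apply: cmeasurableM => //; exact: cmeasurable_cst.
- by apply: aeW => x; rewrite normcM exprMn.
- by move=> x; rewrite -EFinM lee_fin mulr_ge0// sqr_ge0.
- rewrite ge0_integralZl_EFin ?sqr_ge0//.
  + by rewrite lte_mul_pinfty ?lee_fin ?sqr_ge0//; case: f2.
  + by move=> x _; rewrite lee_fin sqr_ge0.
  + exact: measurable_N2.
Qed.

Lemma L2_0 : L2 mu (fun=> 0).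
Proof.
split; [exact: measurable_cst|exact: measurable_cst|].
by rewrite /sqnormL2; under eq_integral do rewrite normc0 expr0n; rewrite integral0 ltry.
Qed.

Lemma L2_sum (J : Type) (s : seq J) (h : J -> X -> R[i]) :
  (forall j, L2 mu (h j)) -> L2 mu (fun x => \sum_(j <- s) h j x).
Proof.
move=> h2; elim: s => [|j s IH]; first by under eq_fun do rewrite big_nil; exact: L2_0.
by under eq_fun do rewrite big_cons; exact: L2D.
Qed.

Lemma L2B f g : L2 mu f -> L2 mu g -> L2 mu (fun x => f x - g x).
Proof.
move=> f2 g2; have := L2D f2 (L2Z (-1) g2).
by under eq_fun do rewrite mulN1r.
Qed.

Lemma L2_ae f g : L2 mu f -> meas g -> {ae mu, forall x : borel X, f x = g x} -> L2 mu g.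
Proof.
move=> f2 mg fg; have mf := L2_meas f2.
apply: L2_le mg (measurable_N2 mf) _ _ _.
- by apply: filterS fg => x /= ->.
- by move=> x; rewrite lee_fin sqr_ge0.
- by case: f2.
Qed.

(** By xy <= x^2 + y^2; the bound is uniform for [f] in the unit sphere, which is
    how it is applied to the basis. *)
Lemma L2_mul f g : L2 mu f -> L2 mu g ->
  cintegrable mu (fun x => f x * (g x)^*%C) /\
  (\int[mu]_x (normc (f x * (g x)^*%C))%:E <= sqnormL2 mu f + sqnormL2 mu g)%E.
Proof.
move=> f2 g2; have mf := L2_meas f2; have mg := L2_meas g2.
have mm : meas (fun x => f x * (g x)^*%C).
  by apply: cmeasurableM => //; exact: cmeasurable_conj.
have le2 x : ((normc (f x * (g x)^*%C))%:E <= N2 f x + N2 g x)%E.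
  by rewrite -EFinD lee_fin normcM normc_conj mulr_le_sqr ?normc_ge0.
have m2 : measurable_fun setT (fun x => N2 f x + N2 g x)%E.
  by apply: emeasurable_funD; exact: measurable_N2.
have intE : (\int[mu]_x (N2 f x + N2 g x) = sqnormL2 mu f + sqnormL2 mu g)%E.
  rewrite ge0_integralD//.
  + by move=> x _; rewrite lee_fin sqr_ge0.
  + exact: measurable_N2.
  + by move=> x _; rewrite lee_fin sqr_ge0.
  + exact: measurable_N2.
split.
  apply: cintegrable_le mm m2 le2 _; rewrite intE.
  by apply: lte_add_pinfty; [case: f2|case: g2].
rewrite -intE; apply: ge0_le_integral => //.
- by move=> x _; rewrite lee_fin normc_ge0.
- by apply/measurable_EFinP; exact: measurable_normc.
Qed.

Lemma ipL2E f g : ipL2 mu f g = cint mu (fun x => f x * (g x)^*%C).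
Proof. by []. Qed.

Lemma ipL2D f g h : L2 mu f -> L2 mu g -> L2 mu h ->
  ipL2 mu (fun x => f x + g x) h = ipL2 mu f h + ipL2 mu g h.
Proof.
move=> f2 g2 h2; rewrite !ipL2E -cintD; [|exact: (L2_mul _ _).1|exact: (L2_mul _ _).1].
by apply: eq_cint => x; rewrite mulrDl.
Qed.

Lemma ipL2Z c f h : L2 mu f -> L2 mu h -> ipL2 mu (fun x => c * f x) h = c * ipL2 mu f h.
Proof.
move=> f2 h2; rewrite !ipL2E -cintZ; last exact: (L2_mul _ _).1.
by apply: eq_cint => x; rewrite mulrA.
Qed.

Lemma ipL2_conj f g : L2 mu f -> L2 mu g -> ipL2 mu g f = (ipL2 mu f g)^*%C.
Proof.
move=> f2 g2; have [fg _] := L2_mul f2 g2.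
rewrite /ipL2/=; congr Complex.
  by apply: eq_Rintegral => x _; case: (f x) => a b; case: (g x) => c d /=; ring.
rewrite -[RHS]mulN1r -RintegralZl//; last exact: (cintegrable_Im fg).
by apply: eq_Rintegral => x _; case: (f x) => a b; case: (g x) => c d /=; ring.
Qed.

Lemma ipL2_ae f f' g : L2 mu f -> meas f' -> L2 mu g ->
  {ae mu, forall x : borel X, f x = f' x} -> ipL2 mu f g = ipL2 mu f' g.
Proof.
move=> f2 mf' g2 ff'; apply: ae_eq_cint.
- by apply: cmeasurableM; [exact: L2_meas|apply: cmeasurable_conj; exact: L2_meas].
- by apply: cmeasurableM => //; apply: cmeasurable_conj; exact: L2_meas.
- by apply: filterS ff' => x /= ->.
Qed.

Lemma sqnorm_ip f : L2 mu f -> sqnormL2 mu f = (complex.Re (ipL2 mu f f))%:E.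
Proof.
move=> f2; rewrite /= /Rintegral.
under [X in fine X]eq_integral => x _.
  have -> : complex.Re (f x * (f x)^*%C) = normc (f x) ^+ 2.
    by rewrite normcE_sqr; case: (f x) => a b /=; ring.
  over.
by rewrite fineK// ge0_fin_numE ?sqnorm_ge0//; case: f2.
Qed.

Lemma ae_eq0_sqnorm f : meas f -> sqnormL2 mu f = 0%E ->
  {ae mu, forall x : borel X, f x = 0}.
Proof.
move=> mf f0; have := (ae_eq_integral_abs mu measurableT (measurable_N2 mf)).1.
have -> : (\int[mu]_x `|N2 f x| = 0)%E.
  rewrite -f0; apply: eq_integral => x _.
  by rewrite gee0_abs// lee_fin sqr_ge0.
move=> /(_ erefl); apply: filterS => x /(_ Logic.I) [] /eqP.
by rewrite sqrf_eq0 => /eqP /eq0_normc.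
Qed.

End L2Theory.

(** * Orthonormal expansions *)

Section OrthonormalExpansion.
Context {R : realType} {X : ptopologicalType}.
Variable mu : {measure set (borel X) -> \bar R}.
Context {I : countType}.
Variable e : I -> X -> R[i].
Hypothesis e_basis : orthonormal_basis_L2 mu e.

Local Notation meas f := (cmeasurable (T := borel X) f).

Let e2 i : L2 mu (e i). Proof. by case: e_basis. Qed.
Let eo i j : ipL2 mu (e i) (e j) = (i == j)%:R. Proof. by case: e_basis. Qed.

Lemma sqnorm_basis i : sqnormL2 mu (e i) = 1%E.
Proof. by rewrite sqnorm_ip// eo eqxx. Qed.

(** A pointwise sum: by [ae_casum] it converges absolutely at almost every
    point when [c] is absolutely summable. *)
Definition synth (c : I -> R[i]) (x : X) : R[i] := csum (fun i => c i * e i x).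

Let sumsq (c : I -> R[i]) : asum (fun i => normc (c i)) ->
  (\esum_(i in [set: I]) \int[mu]_x (normc (c i) * normc (e i x) ^+ 2)%:E < +oo)%E.
Proof.
move=> sc; apply: le_lt_trans sc; apply: le_esum => i _.
under eq_integral do rewrite EFinM.
rewrite ge0_integralZl_EFin ?normc_ge0//.
- have := sqnorm_basis i; rewrite /sqnormL2 => ->.
  by rewrite mule1 lee_fin ler_norm.
- by move=> x _; rewrite lee_fin sqr_ge0.
- exact: measurable_N2 (L2_meas (e2 i)).
Qed.

Let msq (c : I -> R[i]) i :
  measurable_fun setT (fun x : borel X => (normc (c i) * normc (e i x) ^+ 2)%:E).
Proof.
apply/measurable_EFinP; apply: measurable_funM; first exact: measurable_cst.
exact: measurable_sqr_normc (L2_meas (e2 i)).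
Qed.

Lemma ae_sumsq (c : I -> R[i]) : asum (fun i => normc (c i)) ->
  {ae mu, forall x : borel X, asum (fun i => normc (c i) * normc (e i x) ^+ 2)}.
Proof.
move=> sc; pose F (x : borel X) : \bar R :=
  (\esum_(i in [set: I]) (normc (c i) * normc (e i x) ^+ 2)%:E)%E.
have F0 x : (0 <= F x)%E.
  by apply: esum_ge0 => i _; rewrite lee_fin mulr_ge0 ?normc_ge0 ?sqr_ge0.
have mF : measurable_fun setT F.
  apply: measurable_esum => [i|i x]; first exact: msq.
  by rewrite lee_fin mulr_ge0 ?normc_ge0 ?sqr_ge0.
have iF : mu.-integrable setT F.
  apply/integrableP; split=> //; under eq_integral do rewrite gee0_abs//.
  rewrite integral_esum; first exact: sumsq.
    by move=> i; exact: msq.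
  by move=> i x; rewrite lee_fin mulr_ge0 ?normc_ge0 ?sqr_ge0.
apply: filterS (integrable_ae measurableT iF) => x /(_ Logic.I).
rewrite ge0_fin_numE//; apply: le_lt_trans; apply: le_esum => i _.
by rewrite ger0_norm// mulr_ge0 ?normc_ge0 ?sqr_ge0.
Qed.

(** Cauchy-Schwarz for the weights [a].  Expanding the sum of a (y - m)^2 for
    m = (sum of a y) / (sum of a + 1) gives it; the summand 1 avoids a
    distinction of cases when all weights vanish. *)
Lemma weighted_cauchy_schwarz (a y : I -> R) : (forall i, 0 <= a i) ->
  (forall i, 0 <= y i) -> asum a -> asum (fun i => a i * y i ^+ 2) ->
  asum (fun i => a i * y i) /\
  rsum (fun i => a i * y i) ^+ 2 <= (rsum a + 1) * rsum (fun i => a i * y i ^+ 2).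
Proof.
move=> a0 y0 sa say.
have say1 : asum (fun i => a i * y i).
  apply: (asum_le _ (asumD sa say)) => i; rewrite ger0_norm ?mulr_ge0//.
  by have := sqr_ge0 (y i - 1); have := a0 i; have := y0 i; nra.
split=> //.
set A := rsum (fun i => a i * y i); set B := rsum (fun i => a i * y i ^+ 2).
set S := rsum a.
have S0 : 0 <= S by exact: rsum_ge0.
pose m := A / (S + 1).
have mA : m * (S + 1) = A by rewrite /m mulfVK// gt_eqF// ltr_wpDl.
have : 0 <= rsum (fun i => a i * y i ^+ 2 - (2 * m * (a i * y i) - m ^+ 2 * a i)).
  apply: rsum_ge0 => i; have := mulr_ge0 (a0 i) (sqr_ge0 (y i - m)); nra.
rewrite rsumB//; last by apply: asumB; exact: asumZ.
rewrite rsumB ?rsumZ//; [|exact: asumZ|exact: asumZ].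
rewrite -/A -/B -/S => h.
have hm := sqr_ge0 m; rewrite -mA in h *; nra.
Qed.

Lemma ae_casum (c : I -> R[i]) : asum (fun i => normc (c i)) ->
  {ae mu, forall x : borel X, casum (fun i => c i * e i x)}.
Proof.
move=> sc; apply: filterS (ae_sumsq sc) => x sx.
have [h _] := weighted_cauchy_schwarz (fun i => normc_ge0 (c i))
   (fun i => normc_ge0 (e i x)) sc sx.
by apply: casum_le h => i; rewrite normcM.
Qed.

Lemma sum_ip_bound (c : I -> R[i]) g : asum (fun i => normc (c i)) -> L2 mu g ->
  (\esum_(i in [set: I]) \int[mu]_x (normc (c i * (e i x * (g x)^*%C)))%:E < +oo)%E.
Proof.
move=> sc g2; pose K := 1 + fine (sqnormL2 mu g).
have KE : (sqnormL2 mu g = (fine (sqnormL2 mu g))%:E)%E.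
  by rewrite fineK// ge0_fin_numE ?sqnorm_ge0//; case: g2.
apply: le_lt_trans (asumZ K sc); apply: le_esum => i _.
have [[mm _] le2] := L2_mul (e2 i) g2.
under eq_integral do rewrite normcM EFinM.
rewrite ge0_integralZl_EFin ?normc_ge0//; last 2 first.
- by move=> x _; rewrite lee_fin normc_ge0.
- by apply/measurable_EFinP; exact: measurable_normc mm.
apply: (@le_trans _ _ ((normc (c i))%:E * K%:E)%E).
  rewrite lee_wpmul2l ?lee_fin ?normc_ge0//; apply: le_trans le2 _.
  by rewrite sqnorm_basis KE /K EFinD.
by rewrite -EFinM lee_fin mulrC ler_norm.
Qed.

Lemma synth_meas (c : I -> R[i]) : asum (fun i => normc (c i)) -> meas (synth c).
Proof.
move=> sc; have mc i : meas (fun x => c i * e i x).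
  by apply: cmeasurableM; [exact: cmeasurable_cst|exact: L2_meas (e2 i)].
have part (h : R[i] -> R) : (forall i, measurable_fun setT (fun x : borel X => h (c i * e i x))) ->
    measurable_fun setT (fun x : borel X => rsum (fun i => h (c i * e i x))).
  move=> mh; pose F i : borel X -> \bar R := EFin \o (fun x : borel X => h (c i * e i x)).
  have mF i : measurable_fun setT (F i) by exact/measurable_EFinP.
  have E x : rsum (fun i => h (c i * e i x)) =
      fine (\esum_(i in [set: I]) (F i)^\+ x)%E - fine (\esum_(i in [set: I]) (F i)^\- x)%E.
    by rewrite /rsum; congr (fine _ - fine _); apply: eq_esum => i _;
      rewrite ?funeposE ?funenegE.
  under eq_fun do rewrite E.
  apply: measurable_funB; apply: measurableT_comp => //; apply: measurable_esum => //.
  - by move=> i; exact: measurable_funepos.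
  - by move=> i; exact: measurable_funeneg.
by split; apply: part => i; case: (mc i).
Qed.

(** The square of the expansion is dominated by the sum of |c_i| |e_i|^2, which
    is integrable term by term. *)
Lemma synth_L2 (c : I -> R[i]) : asum (fun i => normc (c i)) -> L2 mu (synth c).
Proof.
move=> sc; pose F (x : borel X) : \bar R :=
  (\esum_(i in [set: I]) (normc (c i) * normc (e i x) ^+ 2)%:E)%E.
pose K := 4 * (rsum (fun i => normc (c i)) + 1).
have K0 : 0 <= K.
  by rewrite mulr_ge0// addr_ge0// rsum_ge0// => i; exact: normc_ge0.
have F0 x : (0 <= F x)%E.
  by apply: esum_ge0 => i _; rewrite lee_fin mulr_ge0 ?normc_ge0 ?sqr_ge0.
have mF : measurable_fun setT F.
  apply: measurable_esum => [i|i x]; first exact: msq.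
  by rewrite lee_fin mulr_ge0 ?normc_ge0 ?sqr_ge0.
apply: (@L2_le _ _ _ _ (fun x => K%:E * F x)%E).
- exact: synth_meas.
- by apply: emeasurable_funM => //; exact: measurable_cst.
- apply: filterS (ae_sumsq sc) => x sx.
  have [h1 h2] := weighted_cauchy_schwarz (fun i => normc_ge0 (c i))
    (fun i => normc_ge0 (e i x)) sc sx.
  have -> : F x = (rsum (fun i => normc (c i) * normc (e i x) ^+ 2))%:E.
    by rewrite rsumE// => i; rewrite mulr_ge0 ?normc_ge0 ?sqr_ge0.
  rewrite -EFinM lee_fin /K -mulrA.
  apply: le_trans (ler_wpM2l _ h2) => //.
  have hle i : normc (c i * e i x) <= normc (c i) * normc (e i x) by rewrite normcM.
  have := normc_csum hle h1.
  rewrite -/(synth c x); have := normc_ge0 (synth c x).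
  by set u := normc _; set v := rsum _; nra.
- by move=> x; rewrite mule_ge0// ?lee_fin.
- rewrite ge0_integralZl_EFin//; rewrite lte_mul_pinfty ?lee_fin//.
  rewrite integral_esum; first exact: sumsq.
    by move=> i; exact: msq.
  by move=> i x; rewrite lee_fin mulr_ge0 ?normc_ge0 ?sqr_ge0.
Qed.

(** The expansion may be paired term by term, by dominated summation. *)
Lemma ip_synth (c : I -> R[i]) g : asum (fun i => normc (c i)) -> L2 mu g ->
  casum (fun i => c i * ipL2 mu (e i) g) /\
  ipL2 mu (synth c) g = csum (fun i => c i * ipL2 mu (e i) g).
Proof.
move=> sc g2; have mg := L2_meas g2.
have mw i : meas (fun x => c i * (e i x * (g x)^*%C)).
  apply: cmeasurableM; first exact: cmeasurable_cst.
  by apply: cmeasurableM; [exact: L2_meas (e2 i)|exact: cmeasurable_conj].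
have [m1 s1 e1] := cint_csum mw (sum_ip_bound sc g2).
have cE i : cint mu (fun x => c i * (e i x * (g x)^*%C)) = c i * ipL2 mu (e i) g.
  by rewrite cintZ//; exact: (L2_mul _ _).1.
have {}cE : (fun i => cint mu (fun x => c i * (e i x * (g x)^*%C))) =
  (fun i => c i * ipL2 mu (e i) g) by exact/funext.
rewrite -cE; split=> //; rewrite -e1 ipL2E; apply: ae_eq_cint => //.
- apply: cmeasurableM; first exact: synth_meas.
  exact: cmeasurable_conj.
- apply: filterS (ae_casum sc) => x sx.
  rewrite mulrC /synth -csumZ//; apply: eq_csum => i.
  by rewrite [LHS]mulrC mulrA.
Qed.

(** Riesz-Fischer for absolutely summable coefficients: the sum exists pointwise
    and may be paired with the basis term by term. *)
Lemma coef_synth (c : I -> R[i]) : asum (fun i => normc (c i)) ->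
  coefL2 mu e (synth c) = c.
Proof.
move=> sc; apply/funext => k; rewrite /coefL2 (ip_synth sc (e2 k)).2.
rewrite (csum_supp1 (i0 := k)) ?eo ?eqxx ?mulr1// => i /negPf ik.
by rewrite eo ik mulr0.
Qed.

(** If [f] is orthogonal to the basis and [p] is a finite combination of it,
    then |f|^2 and |f - p|^2 - |p|^2 have the same integral; by totality of
    the basis the former is arbitrarily small. *)
Lemma coef_eq0 f : L2 mu f -> (forall i, ipL2 mu f (e i) = 0) ->
  {ae mu, forall x : borel X, f x = 0}.
Proof.
move=> f2 f0; apply: ae_eq0_sqnorm; first exact: (L2_meas f2).
have [_ _ tot] := e_basis.
apply/eqP; rewrite eq_le sqnorm_ge0 andbT; apply/lee_addgt0Pr => eps eps0.
rewrite add0e; have [s [c sc]] := tot f f2 eps eps0.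
pose p x := \sum_(i <- s) c i * e i x.
have p2 : L2 mu p by apply: L2_sum => i; exact: (L2Z (c i) (e2 i)).
have fp2 : L2 mu (fun x => f x - p x) by exact: (L2B f2 p2).
have fp0 : ipL2 mu p f = 0.
  have E : (fun x => p x * (f x)^*%C) = (fun x => \sum_(i <- s) (c i * (e i x * (f x)^*%C))).
    by apply/funext => x; rewrite mulr_suml; apply: eq_bigr => i _; rewrite mulrA.
  have [_ cs] := cint_sum s (fun i => cintegrableZ (c i) (L2_mul (e2 i) f2).1).
  rewrite ipL2E E cs big1// => i _; rewrite cintZ; last exact: (L2_mul (e2 i) f2).1.
  by rewrite -ipL2E (ipL2_conj f2 (e2 i)) f0 /= oppr0 mulr0.
apply: le_trans (ltW sc); rewrite (sqnorm_ip f2) (sqnorm_ip fp2) lee_fin.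
have B g h : L2 mu g -> L2 mu h ->
    ipL2 mu (fun x => g x - p x) h = ipL2 mu g h - ipL2 mu p h.
  move=> g2 h2; have := ipL2D g2 (L2Z (-1) p2) h2; rewrite ipL2Z// mulN1r => <-.
  by congr (ipL2 mu _ _); apply/funext => x; rewrite mulN1r.
pose q x := f x - p x.
have Rc (z : R[i]) : complex.Re z^*%C = complex.Re z by case: z.
have qf : ipL2 mu q f = ipL2 mu f f by rewrite B// fp0 subr0.
have qp : ipL2 mu q p = - ipL2 mu p p.
  by rewrite B// (ipL2_conj p2 f2) fp0 /= oppr0 sub0r.
have p0 : 0 <= complex.Re (ipL2 mu p p) by rewrite -lee_fin -sqnorm_ip// sqnorm_ge0.
rewrite -/q B// (ipL2_conj fp2 f2) (ipL2_conj fp2 p2) -/q qf qp.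
by rewrite ReD ReN !Rc ReN opprK lerDl.
Qed.

Lemma coef_inj f g : L2 mu f -> L2 mu g -> coefL2 mu e f = coefL2 mu e g ->
  {ae mu, forall x : borel X, f x = g x}.
Proof.
move=> f2 g2 fg; have := @coef_eq0 (fun x => f x - g x) (L2B f2 g2).
have fg0 i : ipL2 mu (fun x => f x - g x) (e i) = 0.
  have := ipL2D f2 (L2Z (-1) g2) (e2 i); rewrite ipL2Z// mulN1r.
  have -> : ipL2 mu f (e i) = ipL2 mu g (e i) by exact: (congr1 (@^~ i) fg).
  rewrite subrr => <-.
  by congr (ipL2 mu _ _); apply/funext => x; rewrite mulN1r.
by move=> /(_ fg0); apply: filterS => x /eqP; rewrite subr_eq0 => /eqP.
Qed.

Lemma coef_ae f g : L2 mu f -> meas g -> {ae mu, forall x : borel X, f x = g x} ->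
  coefL2 mu e f = coefL2 mu e g.
Proof. by move=> f2 mg fg; apply/funext => i; exact: ipL2_ae. Qed.

End OrthonormalExpansion.

Section HinfESequences.
Context {R : realType} {X : ptopologicalType}.
Variable mu : {measure set (borel X) -> \bar R}.
Variables (d : nat -> nat) (lam : nat -> R) (e : idx d -> X -> R[i]).
Hypothesis d_lam : spectral_data d lam.
Hypothesis e_basis : orthonormal_basis_L2 mu e.

Lemma HinfE_synth c : rapid (spec_weight lam) c -> HinfE mu lam e (synth e c).
Proof.
move=> cr; have sc : asum (fun i => normc (c i)) by exact: rapid_asum cr.
split; first exact: synth_L2.
by rewrite coef_synth//; apply/rapid_decay_rapid.
Qed.

Lemma HinfE_seqE : HinfE_seq mu lam e = rapid (spec_weight lam).
Proof.
apply/seteqP; split=> c.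
  by move=> [phi [_ phir] ->]; apply/rapid_decay_rapid.
move=> cr; exists (synth e c); first exact: HinfE_synth.
by rewrite coef_synth//; exact: rapid_asum cr.
Qed.

End HinfESequences.

(** * Continuity and volume on a manifold *)

Section Borel.
Context {R : realType} {T : ptopologicalType}.

Lemma borel_open (U : set T) : open U -> measurable (U : set (borel T)).
Proof. by move=> oU; exact: sub_sigma_algebra. Qed.

Lemma borel_closed (U : set T) : closed U -> measurable (U : set (borel T)).
Proof. by move=> /closed_openC/borel_open/measurableC; rewrite setCK. Qed.

Lemma borel_continuous_on (U : set T) (f : T -> R) : open U ->
  {within U, continuous f} -> measurable_fun (U : set (borel T)) (f : borel T -> R).
Proof.
move=> oU; rewrite (continuous_open_subspace _ oU) => /(continuous_inP _ oU) cf.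
apply: (measurability _ (RGenOpens.measurableE R)) => _ [_ [a [b ->] <-]].
by apply: borel_open; exact/cf/interval_open.
Qed.

Lemma borel_continuous (f : T -> R) : continuous f ->
  measurable_fun setT (f : borel T -> R).
Proof.
move=> cf; apply: borel_continuous_on; first exact: openT.
by rewrite continuous_subspace_setT in cf.
Qed.

End Borel.

Section Charts.
Context {R : realType} {X : ptopologicalType} {n : nat}.
Variables (A : set (chart R X n)) (mu : {measure set (borel X) -> \bar R}).
Hypothesis A_smooth : smooth_atlas A.
Hypothesis mu_density : smooth_positive_density A mu.

Lemma chart_continuous c x : A c -> chart_dom c x -> {for x, continuous (chart_fun c)}.
Proof.
move=> Ac cx; have [ch _ _] := A_smooth; have [oD _ + _ _] := ch c Ac.
by rewrite (continuous_open_subspace _ oD) => /(_ x); rewrite inE; exact.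
Qed.

Lemma on_cod_continuous c (S : topologicalType) (g : 'rV[R]_n -> S) y : A c -> chart_cod c y ->
  {within chart_cod c, continuous g} -> {for y, continuous g}.
Proof.
move=> Ac cy; have [ch _ _] := A_smooth; have [_ oD _ _ _] := ch c Ac.
by rewrite (continuous_open_subspace _ oD) => /(_ y); rewrite inE; exact.
Qed.

(** In a chart domain [h \o f] is the composition of the chart with a continuous
    function on an open set; [h] stands for the real or the imaginary part. *)
Lemma smooth_continuous_part (h : R[i] -> R) (f : X -> R[i]) :
  (forall c, A c -> smooth_on (chart_cod c) (fun y => h (f (chart_inv c y)))) ->
  continuous (fun x => h (f x)).
Proof.
move=> sf x; have [ch cov _] := A_smooth; have [c Ac cx] := cov x.
have [oD _ _ _ invK] := ch c Ac.
pose g y := h (f (chart_inv c y)).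
have cg : {for chart_fun c x, continuous g}.
  by apply: (on_cod_continuous Ac); [exists x|case: (sf c Ac 0%N)].
suff : h (f z) @[z --> x] --> g (chart_fun c x) by rewrite /g invK.
have := continuous_comp (chart_continuous Ac cx) cg.
apply: cvg_trans; apply: near_eq_cvg.
have := open_nbhs_nbhs (conj oD cx); apply: filterS => z cz.
by rewrite /= /g invK.
Qed.

Lemma smooth_continuous (f : X -> R[i]) : smooth A f ->
  continuous (fun x => complex.Re (f x)) /\ continuous (fun x => complex.Im (f x)).
Proof.
by move=> sf; split; apply: smooth_continuous_part => c /sf [].
Qed.

Lemma box_measurable (a b : 'rV[R]_n) :
  measurable ([set y : 'rV[R]_n | forall i, a 0 i < y 0 i <= b 0 i] : set (borel 'rV[R]_n)).
Proof.
have cc (i : 'I_n) : continuous (fun y : 'rV[R]_n => y 0 i) by exact: coord_continuous.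
rewrite (_ : [set _ | _] = \bigcap_(i in [set: 'I_n])
  ([set y : 'rV[R]_n | a 0 i < y 0 i] `&` [set y : 'rV[R]_n | y 0 i <= b 0 i])); last first.
  apply/seteqP; split=> y /= h i; first by move=> _; apply/andP; exact: h.
  by have [/= -> ->] := h i Logic.I.
apply: fin_bigcap_measurable => [|i _]; first exact: finite_finset.
apply: measurableI.
- apply: borel_open; rewrite (_ : [set _ | _] = (fun y : 'rV[R]_n => y 0 i) @^-1` `]a 0 i, +oo[%classic).
    by apply: open_comp => [y _|]; [exact: cc|exact: interval_open].
  by apply/seteqP; split=> y /=; rewrite in_itv/= andbT.
- apply: borel_closed; rewrite (_ : [set _ | _] = (fun y : 'rV[R]_n => y 0 i) @^-1` `]-oo, b 0 i]%classic).
    by apply: closed_comp => [y _|]; [exact: cc|exact: interval_closed].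
  by apply/seteqP; split=> y /=; rewrite in_itv.
Qed.

(** A ball of the sup norm lies between two half-open boxes with the same
    centre, and the measure of these is known. *)
Lemma cube_measure (leb : {measure set (borel 'rV[R]_n) -> \bar R}) (y0 : 'rV[R]_n) (r : R) :
  is_lebesgue_measure leb -> 0 < r ->
  (0 < leb (ball y0 r : set 'rV[R]_n) < +oo)%E.
Proof.
move=> isleb r0.
have mball : measurable ((ball y0 r : set 'rV[R]_n) : set (borel 'rV[R]_n)).
  by apply: borel_open; exact: ball_open.
pose lo (s : R) : 'rV[R]_n := \row_i (y0 0 i - s).
pose hi (s : R) : 'rV[R]_n := \row_i (y0 0 i + s).
have leE s : 0 < s -> leb [set y : 'rV[R]_n | forall i, lo s 0 i < y 0 i <= hi s 0 i] =
    ((2 * s) ^+ n)%:E.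
  move=> s0; rewrite isleb; last by move=> i; rewrite !mxE; lra.
  rewrite (eq_bigr (fun=> 2 * s)); last by move=> i _; rewrite !mxE; lra.
  by rewrite prodr_const card_ord.
apply/andP; split.
- apply: (@lt_le_trans _ _ ((2 * (r / 2)) ^+ n)%:E); first by rewrite lte_fin exprn_gt0// mulr_gt0// divr_gt0.
  rewrite -leE ?divr_gt0//; apply: le_measure; rewrite ?inE//; first exact: box_measurable.
  move=> y /= h; split=> // i j; rewrite !ord1 /ball/= ltr_norml.
  by have := h j; rewrite !mxE => /andP[]; lra.
- apply: (@le_lt_trans _ _ ((2 * r) ^+ n)%:E); last exact: ltry.
  rewrite -leE//; apply: le_measure; rewrite ?inE//; first exact: box_measurable.
  move=> y /= [_ h] i; rewrite !mxE; have := h 0 i; rewrite /ball/= ltr_norml => /andP[]; lra.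
Qed.

(** Around every point the density is bounded above and below by positive
    constants, so small neighbourhoods have positive finite measure. *)
Lemma small_nbhs_measure (x : X) (U : set X) : nbhs x U ->
  exists B : set X, [/\ open B, B x, B `<=` U & (0 < mu B < +oo)%E].
Proof.
move=> Ux; have [ch cov _] := A_smooth; have [c Ac cx] := cov x.
have [oD oC cfun cinv invK] := ch c Ac.
have [leb isleb dens] := mu_density; have [rho [srho rho0 muE]] := dens c Ac.
pose y0 := chart_fun c x; have cy0 : chart_cod c y0 by exists x.
have [crho _] := srho 0%N.
have crho0 : {for y0, continuous rho} by exact: (on_cod_continuous Ac).
have cinv0 : {for y0, continuous (chart_inv c)} by exact: (on_cod_continuous Ac).
have r0 := rho0 _ cy0.
have near_y0 : nbhs y0 [set y | [/\ chart_cod c y, U (chart_inv c y),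
    rho y0 / 2 < rho y & rho y < rho y0 + 1]].
  have h1 : nbhs y0 (chart_cod c) by exact: open_nbhs_nbhs.
  have h2 : nbhs y0 (chart_inv c @^-1` U) by apply: cinv0; rewrite invK.
  have h3 : nbhs y0 (rho @^-1` [set z | rho y0 / 2 < z]).
    by apply: crho0; apply: lt_nbhsr; lra.
  have h4 : nbhs y0 (rho @^-1` [set z | z < rho y0 + 1]).
    by apply: crho0; apply: lt_nbhsl; lra.
  by apply: filterS (filterI (filterI h1 h2) (filterI h3 h4)) => y [[? ?] [? ?]].
have /nbhs_ballP[r /= r_gt0 ball_r] := near_y0.
pose V := (ball y0 r : set 'rV[R]_n).
have oV : open V by exact: ball_open.
pose B := chart_dom c `&` chart_fun c @^-1` V.
have oB : open B.
  move: cfun; rewrite (continuous_open_subspace _ oD) => /(continuous_inP _ oD).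
  exact.
have imB : chart_fun c @` B = V.
  apply/seteqP; split=> [_ [z [_ ?] <-]//|y Vy].
  by have [[z cz zy] _ _ _] := ball_r y Vy; exists z => //; split=> //; rewrite /preimage/= zy.
have muB : mu B = (\int[leb]_(y in V) (rho y)%:E)%E.
  by rewrite muE ?imB//; [exact: borel_open|exact: subIsetl].
have VC : V `<=` chart_cod c by move=> y /ball_r [].
have mV : measurable (V : set (borel 'rV[R]_n)) by exact: borel_open.
have mrho : measurable_fun (V : set (borel 'rV[R]_n)) (EFin \o rho).
  apply/measurable_EFinP; apply: (@measurable_funS _ _ (borel 'rV[R]_n) _ (chart_cod c) V) => //; first exact: borel_open.
  exact: borel_continuous_on.
have /andP[lV1 lV2] := cube_measure y0 isleb r_gt0.
exists B; split=> //.
- split=> //; rewrite /preimage/=; exact: ballxx.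
- move=> z [cz /ball_r [_ + _ _]]; by rewrite invK.
rewrite muB; apply/andP; split.
- apply: (@lt_le_trans _ _ ((rho y0 / 2)%:E * leb V)%E).
    by rewrite mule_gt0// lte_fin divr_gt0.
  rewrite -integral_cst//; apply: ge0_le_integral => //.
  + by move=> y _; rewrite lee_fin divr_ge0// ltW.
  + by move=> y /ball_r [_ _ + _]; rewrite lee_fin => /ltW.
- apply: (@le_lt_trans _ _ ((rho y0 + 1)%:E * leb V)%E); last first.
    by rewrite lte_mul_pinfty// lee_fin addr_ge0// ltW.
  rewrite -integral_cst//; apply: ge0_le_integral => //.
  + by move=> y /VC /rho0 /ltW; rewrite lee_fin.
  + by move=> y /ball_r [_ _ _ +]; rewrite lee_fin => /ltW.
Qed.

Lemma open_measure_gt0 (U : set X) (x : X) : open U -> U x -> (0 < mu U)%E.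
Proof.
move=> oU Ux; have [B [oB Bx BU /andP[B0 _]]] := small_nbhs_measure (open_nbhs_nbhs (conj oU Ux)).
apply: lt_le_trans B0 _; apply: le_measure; rewrite ?inE//; exact: borel_open.
Qed.

Hypothesis X_compact : compact [set: X].

Lemma finite_measure : (mu [set: X] < +oo)%E.
Proof.
have hB x : exists B : set X, [/\ open B, B x & (mu B < +oo)%E].
  have [B [oB Bx _ /andP[_ ?]]] := small_nbhs_measure (@filterT _ (nbhs x) _).
  by exists B.
have [B HB] := choice hB.
have := X_compact; rewrite compact_cover => /(_ X setT B).
case=> [x _|x _|D _ cov]; first by have [] := HB x.
  by exists x => //; have [] := HB x.
pose S : set X := \big[setU/set0]_(x <- finmap.enum_fset D) B x.
have TS : [set: X] `<=` S.
  move=> x /cov [y yD Byx]; rewrite /S -bigcup_seq; exists y => //=.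
have mS (s : seq X) : measurable ((\big[setU/set0]_(x <- s) B x) : set (borel X)) /\
    (mu (\big[setU/set0]_(x <- s) B x) < +oo)%E.
  elim: s => [|x s [IH1 IH2]]; first by rewrite big_nil; split=> //; rewrite measure0.
  have mBx : measurable (B x : set (borel X)) by apply: borel_open; have [] := HB x.
  rewrite big_cons; split; first exact: measurableU.
  apply: le_lt_trans (measureU2 mu mBx IH1) _; apply: lte_add_pinfty => //.
  by have [] := HB x.
apply: le_lt_trans _ (mS (finmap.enum_fset D)).2; apply: le_measure; rewrite ?inE//.
exact: (mS _).1.
Qed.

Lemma continuous_bounded (f : X -> R) : continuous f -> exists K, forall x, `|f x| <= K.
Proof.
move=> cf; have : compact (f @` [set: X]).
  by apply: continuous_compact => //; move: cf; rewrite continuous_subspace_setT.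
move=> /compact_bounded [M [_ HM]]; exists (M + 1) => x.
by apply: (HM (M + 1)); rewrite ?ltrDl//; exists x.
Qed.

Lemma continuous_integrable (f : X -> R) (B : set X) : measurable (B : set (borel X)) ->
  continuous f -> mu.-integrable (B : set (borel X)) (EFin \o (f : borel X -> R)).
Proof.
move=> mB cf; apply: (@integrableS _ _ _ _ setT) => //.
apply: measurable_bounded_integrable => //.
- exact: finite_measure.
- exact: borel_continuous.
- have [K HK] := continuous_bounded cf.
  by exists K; split; rewrite ?num_real// => M KM x _; apply: le_trans (HK x) (ltW KM).
Qed.

(** If f x > K, then the average of [f] over the open set where [f] exceeds the
    midpoint of K and f x is larger than K. *)
Lemma continuous_le_average (f : X -> R) (K : R) : continuous f ->
  (forall B : set (borel X), measurable B -> 0 < fine (mu B) ->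
     \int[mu]_(x in B) f x <= K * fine (mu B)) ->
  forall x, f x <= K.
Proof.
move=> cf avg x; rewrite leNgt; apply/negP => Kfx.
pose K' := (f x + K) / 2.
pose B := f @^-1` [set z | K' < z].
have oB : open B by apply: open_comp => // y _; exact: cf.
have Bx : B x by rewrite /B /preimage/= /K'; lra.
have mB : measurable (B : set (borel X)) by exact: borel_open.
have muB : 0 < fine (mu B).
  rewrite fine_gt0// (open_measure_gt0 oB Bx)/=.
  by apply: le_lt_trans finite_measure; apply: le_measure; rewrite ?inE.
have := avg B mB muB; apply/negP; rewrite -ltNge.
apply: (@lt_le_trans _ _ (K' * fine (mu B))); first by rewrite ltr_pM2r// /K'; lra.
rewrite -Rintegral_cst//; apply: le_Rintegral => //.
- apply: (@continuous_integrable (fun=> K')) => // y; exact: cst_continuous.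
- exact: continuous_integrable.
- by move=> y; exact: ltW.
Qed.

Lemma continuous_norm_average (f : X -> R) (K : R) : continuous f ->
  (forall B : set (borel X), measurable B -> 0 < fine (mu B) ->
     `|\int[mu]_(x in B) f x| <= K * fine (mu B)) ->
  forall x, `|f x| <= K.
Proof.
move=> cf avg x; rewrite ler_norml lerNl; apply/andP; split.
- apply: (@continuous_le_average (fun x => - f x)) => [y|B mB B0]; first exact/continuousN/cf.
  have -> : \int[mu]_(x in B) - f x = - \int[mu]_(x in B) f x.
    rewrite -[RHS]mulN1r -RintegralZl//; last exact: continuous_integrable.
    by apply: eq_Rintegral => y _; rewrite mulN1r.
  by have := avg B mB B0; rewrite ler_norml => /andP[]; rewrite lerNl.
- apply: continuous_le_average => // B mB B0; apply: le_trans (avg B mB B0); exact: ler_norm.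
Qed.

End Charts.

(** * The delta mapping *)

Section Continuous.
Context {R : realType} {X : topologicalType}.
Implicit Types f g : X -> R[i].

Definition ccontinuous f : Prop :=
  continuous (fun x => complex.Re (f x)) /\ continuous (fun x => complex.Im (f x)).

Lemma ccontinuousD f g : ccontinuous f -> ccontinuous g -> ccontinuous (fun x => f x + g x).
Proof.
move=> [f1 f2] [g1 g2]; split=> x.
- by under eq_fun do rewrite ReD; apply: cvgD; [exact: f1|exact: g1].
- by under eq_fun do rewrite ImD; apply: cvgD; [exact: f2|exact: g2].
Qed.

Lemma ccontinuousZ (c : R[i]) f : ccontinuous f -> ccontinuous (fun x => c * f x).
Proof.
move=> [f1 f2]; split=> x.
- under eq_fun do rewrite ReM; apply: cvgB; apply: cvgM; try exact: cvg_cst.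
  + exact: f1.
  + exact: f2.
- under eq_fun do rewrite ImM; apply: cvgD; apply: cvgM; try exact: cvg_cst.
  + exact: f2.
  + exact: f1.
Qed.

Lemma ccontinuous_sum (J : Type) (s : seq J) (f : J -> X -> R[i]) :
  (forall j, ccontinuous (f j)) -> ccontinuous (fun x => \sum_(j <- s) f j x).
Proof.
move=> cf; elim: s => [|j s IH].
  by under eq_fun do rewrite big_nil; split=> x; exact: cvg_cst.
by under eq_fun do rewrite big_cons; exact: ccontinuousD.
Qed.

End Continuous.

Section Delta.
Context {R : realType} {X : ptopologicalType} {n : nat}.
Variables (A : set (chart R X n)) (mu : {measure set (borel X) -> \bar R}).
Hypothesis X_compact : compact [set: X].
Hypothesis A_smooth : smooth_atlas A.
Hypothesis mu_density : smooth_positive_density A mu.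

Local Notation meas f := (cmeasurable (T := borel X) f).
Local Notation vol B := (fine (mu B)).

Let mufin := finite_measure A_smooth mu_density X_compact.

Lemma ccontinuous_meas (f : X -> R[i]) : ccontinuous f -> meas f.
Proof. by move=> [f1 f2]; split; exact: borel_continuous. Qed.

Lemma smooth_ccontinuous (f : X -> R[i]) : smooth A f -> ccontinuous f.
Proof. exact: smooth_continuous. Qed.

Lemma ccontinuous_bounded (f : X -> R[i]) : ccontinuous f ->
  exists K, forall x, normc (f x) <= K.
Proof.
move=> [/(continuous_bounded X_compact) [K1 h1] /(continuous_bounded X_compact) [K2 h2]].
by exists (K1 + K2) => x; apply: le_trans (normc_le_ReIm _) (lerD (h1 x) (h2 x)).
Qed.

Lemma bounded_L2 (f : X -> R[i]) (K : R) : meas f -> (forall x, normc (f x) <= K) -> L2 mu f.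
Proof.
move=> mf fK; apply: (@L2_le _ _ _ _ (fun=> (K ^+ 2)%:E)) => //.
- by apply: aeW => x; rewrite lee_fin ler_sqr ?nnegrE ?normc_ge0//; exact: le_trans (normc_ge0 _) (fK x).
- by move=> x; rewrite lee_fin sqr_ge0.
- by rewrite integral_cst// lte_mul_pinfty// lee_fin sqr_ge0.
Qed.

(** Complex-valued, so that integrals over [B] are inner products. *)
Definition cindic (B : set X) (x : X) : R[i] := (\1_B x)%:C%C.

Lemma cindic_L2 (B : set (borel X)) : measurable B -> L2 mu (cindic B).
Proof.
move=> mB; apply: (@bounded_L2 _ 1).
- by split=> /=; [exact: measurable_indic|exact: measurable_cst].
- by move=> x; rewrite normc_real indicE; case: (_ \in _); rewrite ?normr1 ?normr0.
Qed.

Lemma ip_cindic (f : X -> R[i]) (B : set (borel X)) :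
  ipL2 mu f (cindic B) =
  Complex (\int[mu]_(x in B) complex.Re (f x)) (\int[mu]_(x in B) complex.Im (f x)).
Proof.
rewrite /ipL2; congr Complex; rewrite [RHS]Rintegral_mkcond; apply: eq_Rintegral => x _;
  rewrite patchE /cindic indicE; case: (f x) => a b; case: (_ \in _) => /=;
  by [ring|rewrite oppr0 !mulr0 ?subr0 ?addr0].
Qed.

Lemma normc_average (f : X -> R[i]) (K : R) : ccontinuous f ->
  (forall B : set (borel X), measurable B -> 0 < vol B ->
     normc (ipL2 mu f (cindic B)) <= K * vol B) ->
  forall x, normc (f x) <= 2 * K.
Proof.
move=> [f1 f2] avg x; apply: le_trans (normc_le_ReIm _) _; rewrite mulrDl mul1r lerD//.
- apply: (continuous_norm_average A_smooth mu_density X_compact f1) => B mB B0.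
  by apply: le_trans (avg B mB B0); rewrite ip_cindic; exact: (normr_Re_le (Complex _ _)).
- apply: (continuous_norm_average A_smooth mu_density X_compact f2) => B mB B0.
  by apply: le_trans (avg B mB B0); rewrite ip_cindic; exact: (normr_Im_le (Complex _ _)).
Qed.

Variables (d : nat -> nat) (lam : nat -> R) (e : idx d -> X -> R[i]).
Hypothesis d_lam : spectral_data d lam.
Hypothesis e_basis : orthonormal_basis_L2 mu e.
Hypothesis HinfE_smooth : HinfE_eq_smooth A mu lam e.

Local Notation L := (spec_weight lam).
Local Notation coef := (coefL2 mu e).
Local Notation HF := (HinfE_fun A mu lam e).

Let L0 (i : idx d) : 0 < L i. Proof. exact: spectral_weight_pos. Qed.
Let e2 i : L2 mu (e i). Proof. by case: e_basis. Qed.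

Lemma HinfE_fun_ccontinuous f : HF f -> ccontinuous f.
Proof. by move=> [/smooth_ccontinuous]. Qed.

Lemma HinfE_fun_L2 f : HF f -> L2 mu f.
Proof. by move=> [_ []]. Qed.

Lemma HinfE_fun_rapid f : HF f -> rapid L (coef f).
Proof. by move=> [_ [_]]; apply: (rapid_decay_rapid (coef f) d_lam).1. Qed.

(** The expansion with coefficients [c] is only a measurable function; being in
    H^oo_E it coincides almost everywhere with a smooth one. *)
Lemma HinfE_fun_exists c : rapid L c -> exists2 f, HF f & coef f = c.
Proof.
move=> cr; have sc := rapid_asum cr.
have Hc := HinfE_synth d_lam e_basis cr; have s2 := synth_L2 e_basis sc.
have [psi spsi cpsi] := (HinfE_smooth s2).1 Hc.
have mpsi := ccontinuous_meas (smooth_ccontinuous spsi).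
have coefpsi : coef psi = c by rewrite -(coef_ae e_basis s2 mpsi cpsi) coef_synth.
exists psi; last exact: coefpsi.
split; first exact: spsi.
split; first exact: L2_ae s2 mpsi cpsi.
by rewrite coefpsi; apply/(rapid_decay_rapid c d_lam).
Qed.

(** A smooth function agrees almost everywhere with the pointwise sum of its
    expansion, whichever representatives of the basis functions are used. *)
Lemma ip_expand f g : HF f -> L2 mu g ->
  casum (fun i => coef f i * ipL2 mu (e i) g) /\
  ipL2 mu f g = csum (fun i => coef f i * ipL2 mu (e i) g).
Proof.
move=> Hf g2; have sc := rapid_asum (HinfE_fun_rapid Hf).
have [s1 <-] := ip_synth e_basis sc g2; split=> //.
have s2 := synth_L2 e_basis sc.
apply: ipL2_ae => //; [exact: HinfE_fun_L2|exact: L2_meas s2|].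
by apply: (coef_inj e_basis (HinfE_fun_L2 Hf) s2); rewrite coef_synth.
Qed.

(** Smooth functions are bounded on the compact space [X], so the averages over
    the sets [B] are functionals that are bounded at each point of H^oo_E; the
    gliding hump makes their coordinates uniformly bounded.  This plays the
    role of the closed graph theorem for H^oo_E inside C(X). *)
Lemma basis_average (b : idx d -> R) :
  (forall i, 0 <= b i) -> rapid L (fun i => (b i)%:C%C) ->
  exists K : R, forall B : set (borel X), measurable B -> 0 < vol B ->
    forall i, b i * normc (ipL2 mu (e i) (cindic B)) <= K * vol B.
Proof.
move=> b0 br.
pose P := {B : set (borel X) | measurable B /\ 0 < vol B}.
pose T (p : P) i : R[i] := ((vol (sval p))^-1)%:C%C * ipL2 mu (e i) (cindic (sval p)).
have nT (p : P) z : normc (((vol (sval p))^-1)%:C%C * z) = (vol (sval p))^-1 * normc z.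
  by rewrite normcM normc_real ger0_norm// invr_ge0 ltW//; case: (svalP p).
have sb : asum b.
  by apply: asum_le (rapid_asum br) => i; rewrite normc_real.
have [K HK] : exists K : R, forall p i, b i * normc (T p i) <= K.
  apply: complex_gliding_hump => //.
  - move=> p; have [mB B0] := svalP p; have i2 := cindic_L2 mB.
    pose N := 1 + fine (sqnormL2 mu (cindic (sval p))).
    exists (rsum (fun i => `|b i|) * ((vol (sval p))^-1 * (2 * N))) => i.
    apply: ler_pM => //; [exact: normc_ge0|by have := asum_coef i sb; rewrite ger0_norm|].
    have iv0 : 0 <= (vol (sval p))^-1 by rewrite invr_ge0 ltW.
    rewrite /T nT ler_wpM2l// ipL2E.
    have [ci cn] := L2_mul (e2 i) i2.
    apply: normc_cint => //; apply: le_trans cn _.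
    rewrite (sqnorm_basis e_basis) /N EFinD fineK// ge0_fin_numE ?sqnorm_ge0//.
    by case: i2.
  - move=> c cb.
    have cr : rapid L (fun i => (c i)%:C%C).
      apply: (@rapid_le _ _ L _ _ 1 _ br) => i; rewrite !normc_real mul1r.
      by rewrite (le_trans (cb i))// ler_norm.
    have [f Hf fc] := HinfE_fun_exists cr.
    have cf := HinfE_fun_ccontinuous Hf.
    have [K HK] := ccontinuous_bounded cf; exists (2 * K) => p.
    have [mB B0] := svalP p; have i2 := cindic_L2 mB.
    have [sw E] := ip_expand Hf i2.
    have -> : csum (fun i => (c i)%:C%C * T p i) =
        ((vol (sval p))^-1)%:C%C * ipL2 mu f (cindic (sval p)).
      rewrite E -csumZ//; apply: eq_csum => i.
      by rewrite /T fc mulrCA.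
    rewrite nT mulrC ler_pdivrMr// -mulrA ipL2E.
    have [ci _] := L2_mul (HinfE_fun_L2 Hf) i2.
    apply: normc_cint => //.
    have volE : (mu (sval p) = (vol (sval p))%:E)%E.
      by rewrite fineK// ge0_fin_numE//; apply: le_lt_trans mufin; apply: le_measure; rewrite ?inE.
    apply: (@le_trans _ _ (\int[mu]_(x in sval p) K%:E)%E); last first.
      by rewrite integral_cst// EFinM -volE.
    rewrite [leRHS]integral_mkcond; apply: ge0_le_integral => //.
    + by move=> x _; rewrite lee_fin normc_ge0.
    + by apply/measurable_EFinP; exact: measurable_normc ci.1.
    + by apply/(measurable_restrictT _ mB); exact: measurable_cst.
    + move=> x _; rewrite patchE normcM normc_conj normc_real indicE.
      case: (_ \in _); first by rewrite normr1 mulr1 lee_fin.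
      by rewrite normr0 mulr0.
exists K => B mB B0 i; have := HK (exist _ B (conj mB B0)) i.
by rewrite /T nT /= mulrCA mulrC ler_pdivrMr.
Qed.

Lemma smooth_basis_exists (i : idx d) :
  exists f, HF f /\ forall g, L2 mu g -> ipL2 mu f g = ipL2 mu (e i) g.
Proof.
have [f Hf fc] := HinfE_fun_exists (rapid_unit L i).
exists f; split=> // g g2; apply: ipL2_ae => //; [exact: HinfE_fun_L2|exact: L2_meas (e2 i)|].
apply: (coef_inj e_basis (HinfE_fun_L2 Hf) (e2 i)).
rewrite fc; apply/funext => k; rewrite /coefL2.
by case: e_basis => _ -> _; rewrite eq_sym.
Qed.

(** The [e i] are determined almost everywhere only, whereas evaluation at a
    point requires their smooth representatives. *)
Definition smooth_basis : idx d -> X -> R[i] := projT1 (choice smooth_basis_exists).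

Lemma smooth_basis_HinfE i : HF (smooth_basis i).
Proof. by case: (projT2 (choice smooth_basis_exists) i). Qed.

Lemma ip_smooth_basis i g : L2 mu g -> ipL2 mu (smooth_basis i) g = ipL2 mu (e i) g.
Proof. by case: (projT2 (choice smooth_basis_exists) i) => _; exact. Qed.

Lemma coef_smooth_basis i : coef (smooth_basis i) = fun k => (k == i)%:R.
Proof.
apply/funext => k; rewrite /coefL2 ip_smooth_basis//.
by case: e_basis => _ -> _; rewrite eq_sym.
Qed.

(** By [basis_average], applied to the coefficients of [f] times a power of the
    weight, the averages of c_i e_i are at most a summable [m i] in modulus.
    The difference of [f] and a finite partial sum is continuous, and its
    averages are bounded by the tail of [m]; hence so are its values. *)
Lemma pointwise_expansion f x : HF f ->
  casum (fun i => coef f i * smooth_basis i x) /\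
  csum (fun i => coef f i * smooth_basis i x) = f x.
Proof.
move=> Hf; have [s0 sL] := spectral_weight_asum d_lam.
pose c := coef f; pose b i := L i `^ s0 * normc (c i).
have cr : rapid L c := HinfE_fun_rapid Hf.
have b0 i : 0 <= b i by rewrite mulr_ge0 ?powR_ge0 ?normc_ge0.
have br : rapid L (fun i => (b i)%:C%C).
  apply: (@rapid_le _ _ L _ _ 1 _ (rapid_weight L0 s0 cr)) => i.
  rewrite normcM !normc_real mul1r ger0_norm ?b0// ger0_norm ?powR_ge0//.
have [K HK] := basis_average b0 br.
(* The factor L^s0 in [b] is given back here to gain summability. *)
pose m (i : idx d) : R := `|K| * L i `^ (- s0).
have m0 i : 0 <= m i by rewrite mulr_ge0 ?powR_ge0.
have sm : asum m by exact: asumZ.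
have avg (B : set (borel X)) i : measurable B -> 0 < vol B ->
    normc (c i * ipL2 mu (e i) (cindic B)) <= m i * vol B.
  move=> mB B0; have := HK B mB B0 i; rewrite normcM /m /b.
  set z := normc (ipL2 _ _ _) => h.
  have p0 : 0 <= L i `^ (- s0) by exact: powR_ge0.
  have := ler_wpM2l p0 h; rewrite !mulrA powR_cancel// mul1r => /le_trans; apply.
  by rewrite ler_wpM2r ?(ltW B0)// mulrC ler_wpM2r// ler_norm.
have bnd i : normc (c i * smooth_basis i x) <= 2 * m i.
  apply: (@normc_average (fun x => c i * smooth_basis i x)).
    by apply: ccontinuousZ; exact: HinfE_fun_ccontinuous (smooth_basis_HinfE i).
  move=> B mB B0; have i2 := cindic_L2 mB.
  rewrite ipL2Z ?ip_smooth_basis//; first exact: avg.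
  exact: HinfE_fun_L2 (smooth_basis_HinfE i).
have sw : casum (fun i => c i * smooth_basis i x).
  by apply: casum_le bnd _; exact: asumZ.
split=> //; apply/eqP; rewrite eq_sym -subr_eq0; apply/eqP.
suff small eps : 0 < eps -> normc (f x - csum (fun i => c i * smooth_basis i x)) <= eps.
  apply: eq0_normc; apply/eqP; rewrite eq_le normc_ge0 andbT.
  by apply/ler_addgt0Pr => eps /small; rewrite add0r.
move=> eps0.
(* Four tails arise for [f] minus the partial sum and four for the series. *)
have e8 : 0 < eps / 8 by rewrite divr_gt0.
have [s us hs] := asum_tail e8 m0 sm.
have ms : asum (fun i => if i \in s then 0 else m i).
  by apply: asum_le sm => i; case: ifP => _; rewrite ?normr0 ?ger0_norm.
set t := rsum _ in hs.
pose g y := f y + (-1) * \sum_(i <- s) c i * smooth_basis i y.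
have sb2 i : L2 mu (fun y => c i * smooth_basis i y).
  by apply: L2Z; exact: HinfE_fun_L2 (smooth_basis_HinfE i).
have gx : normc (g x) <= 2 * (2 * t).
  apply: normc_average.
    apply: ccontinuousD; first exact: HinfE_fun_ccontinuous.
    apply: ccontinuousZ; apply: ccontinuous_sum => i.
    by apply: ccontinuousZ; exact: HinfE_fun_ccontinuous (smooth_basis_HinfE i).
  move=> B mB B0; have i2 := cindic_L2 mB.
  have [se E] := ip_expand Hf i2.
  have -> : ipL2 mu g (cindic B) =
      csum (fun i => if i \in s then 0 else c i * ipL2 mu (e i) (cindic B)).
    rewrite ipL2D ?ipL2Z//; [|exact: L2_sum|exact: HinfE_fun_L2|by apply: L2Z; exact: L2_sum].
    have -> : ipL2 mu (fun y => \sum_(i <- s) c i * smooth_basis i y) (cindic B) =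
        \sum_(i <- s) c i * ipL2 mu (e i) (cindic B).
      rewrite ipL2E.
      have -> : (fun y => (\sum_(i <- s) c i * smooth_basis i y) * (cindic B y)^*%C) =
          (fun y => \sum_(i <- s) (c i * smooth_basis i y * (cindic B y)^*%C)).
        by apply/funext => y; rewrite mulr_suml.
      have [_ ->] := cint_sum s (fun i => (L2_mul (sb2 i) i2).1).
      apply: eq_bigr => i _; rewrite -ipL2E ipL2Z ?ip_smooth_basis//.
      exact: HinfE_fun_L2 (smooth_basis_HinfE i).
    by rewrite E (csum_split us se) mulN1r addrAC subrr add0r.
  have -> : 2 * t * vol B = 2 * rsum (fun i => vol B * (if i \in s then 0 else m i)).
    by rewrite (rsumZ _ ms) -/t -mulrA [t * _]mulrC.
  apply: normc_csum; last exact: (asumZ (vol B) ms).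
  move=> i; case: ifP => _; first by rewrite normc0 mulr0.
  by rewrite [leRHS]mulrC; exact: avg.
rewrite (csum_split us sw) opprD addrA.
apply: le_trans (normc_triangle _ _) _.
have -> : f x - \sum_(i <- s) c i * smooth_basis i x = g x by rewrite /g mulN1r.
rewrite normc_opp.
have tl : normc (csum (fun i => if i \in s then 0 else c i * smooth_basis i x)) <= 2 * (2 * t).
  rewrite -(rsumZ 2 ms); apply: normc_csum; last exact: (asumZ 2 ms).
  by move=> i; case: ifP => _; [rewrite normc0 mulr0|exact: bnd].
apply: le_trans (lerD gx tl) _.
by move: hs; rewrite ler_pdivlMr//; lra.
Qed.

(** Uniform bounds that are summable let the inner product pass through a
    pointwise sum, since [mu] is finite. *)
Lemma ip_uniform_sum (J : countType) (phi : J -> X -> R[i]) (m : J -> R) g :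
  (forall k, meas (phi k)) -> (forall k x, normc (phi k x) <= m k) -> asum m ->
  L2 mu g ->
  casum (fun k => ipL2 mu (phi k) g) /\
  ipL2 mu (fun x => csum (phi^~ x)) g = csum (fun k => ipL2 mu (phi k) g).
Proof.
move=> mphi phim sm g2; have mg := L2_meas g2.
have one2 : L2 mu (fun=> 1) by apply: (@bounded_L2 _ 1) => [|x]; [exact: cmeasurable_cst|rewrite normc1].
have mw k : meas (fun x => phi k x * (g x)^*%C).
  by apply: cmeasurableM => //; exact: cmeasurable_conj.
pose K := fine (sqnormL2 mu (fun=> 1)) + fine (sqnormL2 mu g).
have le1 : (\int[mu]_x (normc (g x))%:E <= K%:E)%E.
  have := (L2_mul one2 g2).2; under eq_integral do rewrite mul1r normc_conj.
  by rewrite /K EFinD !fineK// ge0_fin_numE ?sqnorm_ge0//; [case: g2|case: one2].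
have sw : (\esum_(k in [set: J]) \int[mu]_x (normc (phi k x * (g x)^*%C))%:E < +oo)%E.
  apply: le_lt_trans (asumZ K sm); apply: le_esum => k _.
  apply: (@le_trans _ _ (\int[mu]_x (`|m k|%:E * (normc (g x))%:E))%E).
    apply: ge0_le_integral => //.
    - by move=> x _; rewrite lee_fin normc_ge0.
    - by apply/measurable_EFinP; exact: measurable_normc.
    - apply: emeasurable_funM; first exact: measurable_cst.
      by apply/measurable_EFinP; exact: measurable_normc.
    - move=> x _; rewrite -EFinM lee_fin normcM normc_conj ler_wpM2r ?normc_ge0//.
      by apply: le_trans (phim k x) _; exact: ler_norm.
  rewrite ge0_integralZl_EFin//; last 2 first.
  - by move=> x _; rewrite lee_fin normc_ge0.
  - by apply/measurable_EFinP; exact: measurable_normc.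
  rewrite normrM mulrC EFinM lee_wpmul2l ?lee_fin//.
  by apply: le_trans le1 _; rewrite lee_fin ler_norm.
have [m1 s1 e1] := cint_csum mw sw; split=> //; rewrite -e1 ipL2E.
apply: eq_cint => x; rewrite mulrC -csumZ.
  by apply: eq_csum => k; rewrite mulrC.
by apply: casum_le sm => k.
Qed.

Local Notation Hseq := (HinfE_seq mu lam e).

Definition smooth_delta (x : X) (i : idx d) : R[i] := smooth_basis i x.

Lemma smooth_delta_is_delta : is_delta A mu lam e smooth_delta.
Proof.
move=> x; split.
  apply/alpha_dualP => v; rewrite HinfE_seqE// => /HinfE_fun_exists [f Hf <-].
  exact: (pointwise_expansion x Hf).1.
by move=> f Hf; exact: (pointwise_expansion x Hf).2.
Qed.

Lemma is_delta_unique delta : is_delta A mu lam e delta -> smooth_delta = delta.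
Proof.
move=> hd; apply/funext => x; apply/funext => i.
have [_ /(_ _ (smooth_basis_HinfE i))] := hd x.
by rewrite coef_smooth_basis pairingC pairing_unit /smooth_delta => ->.
Qed.

(** By perfectness an element of the bidual decays rapidly, so it is the
    coefficient family of a smooth function, which the delta family evaluates. *)
Lemma bidual_function delta a : is_delta A mu lam e delta ->
  alpha_dual (alpha_dual Hseq) a ->
  HF (fun x => pairing (delta x) a) /\ coef (fun x => pairing (delta x) a) = a.
Proof.
move=> hd; rewrite HinfE_seqE// => /rapid_perfect /HinfE_fun_exists [f Hf <-].
have -> : (fun x => pairing (delta x) (coef f)) = f; last by [].
by apply/funext => x; rewrite pairingC; have [_ ->] := hd x.
Qed.

(** Each component of a sequential linear map is the pairing with an element of
    the bidual, that is, with the coefficients of a smooth function; the values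
    of this function are those of the component on the delta family. *)
Lemma sequential_linear_ext (J : countType) (W : set (J -> R[i]))
    (delta : X -> idx d -> R[i]) (F F' : (idx d -> R[i]) -> (J -> R[i])) :
  is_delta A mu lam e delta ->
  sequential_linear (alpha_dual Hseq) W F -> sequential_linear (alpha_dual Hseq) W F' ->
  (forall x, F (delta x) = F' (delta x)) ->
  forall v, alpha_dual Hseq v -> F v = F' v.
Proof.
move=> hd [_ _ dF] [_ _ dF'] FF' v dv; apply/funext => k.
have [a ba aE] := dF _ (dual_unit k); have [a' ba' aE'] := dF' _ (dual_unit k).
have [_ ca] := bidual_function hd ba.
have [_ ca'] := bidual_function hd ba'.
have dd x : alpha_dual Hseq (delta x) by case: (hd x).
have -> : F v k = pairing v a by rewrite -(pairing_unit (F v)) aE.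
have -> : F' v k = pairing v a' by rewrite -(pairing_unit (F' v)) aE'.
congr (pairing v _); rewrite -ca -ca'; congr (coefL2 mu e _).
by apply/funext => x; rewrite -aE// -aE'// FF'.
Qed.

End Delta.

(** * Coefficient families in a Hilbert space *)

Section RieszFischerHilbert.
Context {R : realType} {G : completeNormedModType R[i]}.
Variable ip : G -> G -> R[i].
Hypothesis ip_hilbert : hilbert_inner_product ip.
Context {I : countType}.
Variable h : I -> G.
Hypothesis h_orth : forall i j, ip (h i) (h j) = (i == j)%:R.

Let ipZD a x y z : ip (a *: x + y) z = a * ip x z + ip y z. Proof. by case: ip_hilbert. Qed.
Let ipC x y : ip y x = (ip x y)^*%C. Proof. by case: ip_hilbert. Qed.
Let ipN x : `|x| ^+ 2 = ip x x. Proof. by case: ip_hilbert. Qed.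

Let ip0 z : ip 0 z = 0.
Proof.
have := ipZD 1 0 0 z; rewrite scaler0 add0r mul1r => /eqP.
by rewrite -subr_eq subrr eq_sym => /eqP.
Qed.

Let ipD x y z : ip (x + y) z = ip x z + ip y z.
Proof. by have := ipZD 1 x y z; rewrite scale1r mul1r. Qed.

Let ipZ a x z : ip (a *: x) z = a * ip x z.
Proof. by have := ipZD a x 0 z; rewrite addr0 ip0 addr0. Qed.

Let ipB x y z : ip (x - y) z = ip x z - ip y z.
Proof. by rewrite -scaleN1r ipD ipZ mulN1r. Qed.

Let norm_h i : `|h i| = 1.
Proof.
have /eqP := ipN (h i); rewrite h_orth eqxx -[X in _ == X](expr1n _ 2) eqrXn2//.
by move=> /eqP.
Qed.

(** The squared norm of x - <x, h_i> h_i is |x|^2 - |<x, h_i>|^2. *)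
Lemma bessel x i : `|ip x (h i)| <= `|x|.
Proof.
pose z := ip x (h i); pose y := x - z *: h i.
have yh : ip y (h i) = 0 by rewrite /y ipB ipZ h_orth eqxx mulr1 subrr.
have hx : ip (h i) x = z^*%C by rewrite ipC.
have yy : ip y y = (`|x| ^+ 2 - `|z| ^+ 2)^*%C.
  rewrite {1}/y ipB ipZ (ipC y (h i)) yh.
  rewrite (ipC y x) {1}/y ipB ipZ hx -ipN -sqr_normc.
  by rewrite [X in z * X](_ : _ = 0) ?mulr0 ?subr0//= oppr0.
have : 0 <= `|x| ^+ 2 - `|z| ^+ 2.
  have : 0 <= ip y y by rewrite -ipN exprn_ge0.
  rewrite yy; case: (_ - _) => a b; rewrite !lecE/= => /andP[/eqP b0 ->].
  by rewrite andbT -[b]opprK b0 oppr0.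
by rewrite subr_ge0 ler_pXn2r// nnegrE.
Qed.

(** Completeness provides the sum of c_i h_i, and coefficients are continuous
    by [bessel]. *)
Lemma hilbert_synth (c : I -> R[i]) : asum (fun i => normc (c i)) ->
  exists psi, forall i, ip psi (h i) = c i.
Proof.
move=> sc.
pose u n : G := oapp (fun i => c i *: h i) 0 (pickle_inv n : option I).
pose a n : R := oapp (fun i => normc (c i)) 0 (pickle_inv n : option I).
have a0 n : 0 <= a n by rewrite /a; case: pickle_inv => //= i; exact: normc_ge0.
have ua n : `|u n| = (a n)%:C%C.
  rewrite /u /a; case: pickle_inv => [i|]/=; last by rewrite normr0.
  by rewrite normrZ norm_h mulr1.
have cvga : cvgn (series a).
  apply: nondecreasing_is_cvgn.
    by apply/nondecreasing_seqP => n; rewrite /series/= big_nat_recr//= lerDl.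
  exists (rsum (fun i => normc (c i))) => _ [M _ <-].
  rewrite -lee_fin rsumE//; last by move=> i; exact: normc_ge0.
  rewrite esum_count; last by move=> i; rewrite lee_fin normc_ge0.
  rewrite /series/= -sumEFin.
  rewrite (eq_bigr (fun n => oapp (fun i => (normc (c i))%:E) 0%E (pickle_inv n : option I))).
    apply: nneseries_lim_ge => n _ _; case: pickle_inv => //= i.
    by rewrite lee_fin normc_ge0.
  by move=> n _; rewrite /a; case: pickle_inv.
have cu : cauchy (series u @ \oo).
  apply/cauchy_seriesP => eps eps0.
  have [r r0 epsE] : exists2 r : R, 0 < r & eps = r%:C%C.
    by case: eps eps0 => r s; rewrite ltcE/= => /andP[/eqP -> r0]; exists r.
  have /cauchy_cvgP/cauchy_seriesP/(_ r r0) := cvga.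
  apply: filterS => -[m n] /= hmn.
  apply: le_lt_trans (ler_norm_sum _ _ _) _.
  under eq_bigr do rewrite ua.
  rewrite -rmorph_sum epsE /= ltcR.
  apply: le_lt_trans hmn; exact: ler_norm.
have /cauchy_cvgP cu' := cu.
pose psi := lim (series u @ \oo); exists psi => i.
have ipS N : (pickle i < N)%N -> ip (series u N) (h i) = c i.
  move=> iN; rewrite /series/= .
  have ip_sum (s : seq nat) : ip (\sum_(n <- s) u n) (h i) = \sum_(n <- s) ip (u n) (h i).
    by elim: s => [|n s IH]; rewrite ?big_nil ?ip0// !big_cons ipD IH.
  rewrite ip_sum (bigD1_seq (pickle i)) ?mem_index_iota ?iota_uniq//=.
  rewrite {1}/u pickleK_inv/= ipZ h_orth eqxx mulr1 big1 ?addr0// => n ni.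
  rewrite /u; case E : (pickle_inv n : option I) => [j|]/=; last exact: ip0.
  rewrite ipZ h_orth; case: eqP => [ji|_]; last by rewrite mulr0.
  have := @pickle_invK I n; rewrite /ocancel E/= => En.
  by rewrite -En ji eqxx in ni.
apply/eqP; rewrite -subr_eq0 -normr_le0; apply/ler_addgt0Pr => eps eps0; rewrite add0r.
have /cvgrPdist_lt /(_ _ eps0) [N _ HN] := cu'.
pose m := maxn N (pickle i).+1.
rewrite -(ipS m) ?leq_maxr// -ipB; apply: le_trans (bessel _ _) _.
by apply: ltW; apply: HN; rewrite /= leq_maxl.
Qed.

End RieszFischerHilbert.

(** Rapid decay alone provides the vector with these coefficients. *)
Lemma GinfF_seqE {R : realType} {G : completeNormedModType R[i]} (ip : G -> G -> R[i])
    (g : nat -> nat) (nu : nat -> R) (h : idx g -> G) :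
  hilbert_inner_product ip -> spectral_data g nu -> orthonormal_basis ip h ->
  GinfF_seq ip nu h = rapid (spec_weight nu).
Proof.
move=> ip_h gnu [ho _]; apply/seteqP; split=> c.
  by move=> [cr _]; apply/(rapid_decay_rapid c gnu).
move=> cr; split; first exact/(rapid_decay_rapid c gnu).
have [psi hpsi] := hilbert_synth ip_h ho (rapid_asum cr).
by exists psi; apply/funext => k; rewrite hpsi.
Qed.

(** * Factorization through the delta mapping *)

Section Factorization.
Context {R : realType} {X : ptopologicalType} {n : nat}.
Variables (A : set (chart R X n)) (mu : {measure set (borel X) -> \bar R}).
Hypothesis X_compact : compact [set: X].
Hypothesis A_smooth : smooth_atlas A.
Hypothesis mu_density : smooth_positive_density A mu.
Variables (d : nat -> nat) (lam : nat -> R) (e : idx d -> X -> R[i]).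
Hypothesis d_lam : spectral_data d lam.
Hypothesis e_basis : orthonormal_basis_L2 mu e.
Hypothesis HinfE_smooth : HinfE_eq_smooth A mu lam e.
Variables (g : nat -> nat) (nu : nat -> R).
Hypothesis g_nu : spectral_data g nu.

Local Notation L := (spec_weight lam).
Local Notation M := (spec_weight nu).
Local Notation coef := (coefL2 mu e).
Local Notation HF := (HinfE_fun A mu lam e).
Local Notation Gdual := (alpha_dual (rapid (spec_weight nu : idx g -> R))).
Local Notation Hdual := (alpha_dual (rapid (spec_weight lam : idx d -> R))).

Let L0 (i : idx d) : 0 < L i. Proof. exact: spectral_weight_pos. Qed.
Let M0 (k : idx g) : 0 < M k. Proof. exact: spectral_weight_pos. Qed.
Let e2 i : L2 mu (e i). Proof. by case: e_basis. Qed.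

Variable f : X -> (idx g -> R[i]).
Hypothesis f_map : HinfE_mapping A mu lam e (rapid (spec_weight nu)) f.

Let f_rapid x : rapid M (f x). Proof. by case: f_map. Qed.
Let f_HF u : Gdual u -> HF (fun x => pairing (f x) u). Proof. by case: f_map => _; exact. Qed.

Let f_comp k : HF (fun x => f x k).
Proof.
have := f_HF (dual_unit k).
by under eq_fun do rewrite pairing_unit.
Qed.

Definition row k : idx d -> R[i] := coef (fun x => f x k).

Lemma row_rapid k : rapid L (row k).
Proof. exact: (HinfE_fun_rapid d_lam (f_comp k)). Qed.

Lemma dual_solid (u : idx g -> R[i]) (c : idx g -> R) (t : R) : Gdual u ->
  (forall k, `|c k| <= M k `^ t * normc (u k)) -> Gdual (fun k => (c k)%:C%C).
Proof.
move=> du cu; apply/alpha_dualP => v vr.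
have /alpha_dualP /(_ _ vr) := dual_weight M0 t du.
apply: casum_le => k; rewrite !normcM !normc_real [`|_ `^ _|]ger0_norm ?powR_ge0//.
by rewrite ler_wpM2l ?normc_ge0.
Qed.

Lemma weighted_bound_ge0 (u : idx g -> R[i]) (t : R) k : 0 <= M k `^ t * normc (u k).
Proof. by rewrite mulr_ge0 ?powR_ge0 ?normc_ge0. Qed.

(** For every [u] in the dual the function x |-> <f x, u> is smooth, hence
    bounded on [X]; so the functionals f x, indexed by the points [x], satisfy
    the hypotheses of the gliding hump.  A power of the weight, put into [b],
    turns the resulting bound into summability. *)
Lemma uniform_summable u : Gdual u ->
  exists2 m : idx g -> R, asum m & forall k x, normc (u k * f x k) <= m k.
Proof.
move=> du; have [t0 sM] := spectral_weight_asum g_nu.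
pose b k := M k `^ t0 * normc (u k).
have [K HK] : exists K : R, forall x k, b k * normc (f x k) <= K.
  apply: complex_gliding_hump.
  - by move=> k; exact: weighted_bound_ge0.
  - move=> x; have := dual_weight M0 t0 du.
    move=> /alpha_dualP /(_ _ (f_rapid x)) s.
    exists (rsum (fun k => `|normc (f x k * ((M k `^ t0)%:C%C * u k))|)) => k.
    apply: le_trans (asum_coef k s); rewrite !normcM normc_real ger0_norm; last first.
      by rewrite !mulr_ge0 ?normc_ge0.
    by rewrite ger0_norm ?powR_ge0// mulrC.
  - move=> c cb; have Hc := f_HF (dual_solid du cb).
    have [K HK] := ccontinuous_bounded X_compact (HinfE_fun_ccontinuous A_smooth Hc).
    exists K => x; have := HK x; rewrite pairingE.
    by under eq_csum do rewrite mulrC.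
exists (fun k => `|K| * M k `^ (- t0)); first exact: asumZ.
move=> k x; have p0 : 0 <= M k `^ (- t0) by exact: powR_ge0.
have := ler_wpM2l p0 (HK x k); rewrite /b !mulrA powR_cancel// mul1r normcM.
by move=> /le_trans; apply; rewrite mulrC ler_wpM2r// ler_norm.
Qed.

(** Uniform convergence permits taking coefficients term by term. *)
Lemma coef_pairing u i : Gdual u ->
  casum (fun k => u k * row k i) /\
  coef (fun x => pairing (f x) u) i = csum (fun k => u k * row k i).
Proof.
move=> du; have [m sm hm] := uniform_summable du.
have mf k : cmeasurable (T := borel X) (fun x => u k * f x k).
  apply: cmeasurableM; first exact: cmeasurable_cst.
  exact: (ccontinuous_meas (HinfE_fun_ccontinuous A_smooth (f_comp k))).
have [s1 s2] := ip_uniform_sum X_compact A_smooth mu_density mf hm sm (e2 i).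
have rE : (fun k => ipL2 mu (fun x => u k * f x k) (e i)) = (fun k => u k * row k i).
  by apply/funext => k; rewrite ipL2Z//; exact: (HinfE_fun_L2 (f_comp k)).
rewrite -rE; split; first exact: s1.
rewrite -s2 /coefL2; congr (ipL2 mu _ _).
by apply/funext => x; rewrite pairingE; apply: eq_csum => k; rewrite mulrC.
Qed.

(** The gliding hump once more, for the functionals u |-> sum_k u_k row_k,i v_i
    indexed by [i]: at [u] they are the products of [v i] and the coefficients of
    x |-> <f x, u>, which decay rapidly, so they are bounded in [i].  Powers of
    both weights are spent on summability. *)
Lemma matrix_summable u v : Gdual u -> Hdual v ->
  dsum (fun k i => normc (u k * (row k i * v i))).
Proof.
move=> du dv; have [t0 sM] := spectral_weight_asum g_nu.
have [s0 sL] := spectral_weight_asum d_lam.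
pose b k := M k `^ t0 * normc (u k).
pose v' i := (L i `^ s0)%:C%C * v i.
have dv' : Hdual v' by exact: dual_weight.
have [K HK] : exists K : R, forall i k, b k * normc (v' i * row k i) <= K.
  apply: complex_gliding_hump.
  - by move=> k; exact: weighted_bound_ge0.
  - move=> i; have [s _] := coef_pairing i (dual_weight M0 t0 du).
    have {}s := casumZ (v' i) s.
    exists (rsum (fun k => `|normc (v' i * ((M k `^ t0)%:C%C * u k * row k i))|)) => k.
    apply: le_trans (asum_coef k s); rewrite ger0_norm ?normc_ge0//.
    by rewrite !normcM (normc_real (M k `^ t0)) [`|M k `^ t0|]ger0_norm ?powR_ge0// mulrCA mulrA.
  - move=> c cb; have dc := dual_solid du cb.
    have rc := HinfE_fun_rapid d_lam (f_HF dc).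
    have /alpha_dualP /(_ _ rc) s := dv'.
    set w := coef _ in s.
    exists (rsum (fun i => `|normc (w i * v' i)|)) => i.
    apply: le_trans (asum_coef i s); rewrite ger0_norm ?normc_ge0//.
    have [s1 wE] := coef_pairing i dc; rewrite /w wE [in leRHS]mulrC -csumZ//.
    by under eq_csum do rewrite mulrCA.
apply: (@dsum_prod _ _ _ _ `|K| (fun k => M k `^ (- t0)) (fun i => L i `^ (- s0))) => // k i.
have p0 : 0 <= M k `^ (- t0) by exact: powR_ge0.
have q0 : 0 <= L i `^ (- s0) by exact: powR_ge0.
have := ler_wpM2l (mulr_ge0 p0 q0) (HK i k).
rewrite /b /v' !normcM normc_real (ger0_norm (powR_ge0 _ _)) ger0_norm; last first.
  by rewrite !mulr_ge0 ?normc_ge0.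
have pM := powR_cancel t0 (M0 k); have pL := powR_cancel s0 (L0 i).
set a1 := M k `^ (- t0) in p0 pM *; set a2 := M k `^ t0 in pM *.
set b1 := L i `^ (- s0) in q0 pL *; set b2 := L i `^ s0 in pL *.
have -> : a1 * b1 * (a2 * normc (u k) * (b2 * normc (v i) * normc (row k i))) =
    (a1 * a2) * (b1 * b2) * (normc (u k) * (normc (row k i) * normc (v i))) by ring.
rewrite pM pL !mul1r => /le_trans; apply.
by rewrite mulrC -mulrA ler_wpM2r ?mulr_ge0// ler_norm.
Qed.

(** The value at delta_x is forced to be f x, and <delta_x, row k> = f x k. *)
Definition extension (v : idx d -> R[i]) (k : idx g) : R[i] := pairing v (row k).

(** Both orders of summation of u_k row_k,i v_i are used: over [i] first it
    pairs [extension v] with [u], over [k] first it gives the coefficients of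
    x |-> <f x, u>. *)
Lemma extension_exchange u v : Gdual u -> Hdual v ->
  casum (fun k => u k * extension v k) /\
  pairing (extension v) u = pairing v (coef (fun x => pairing (f x) u)).
Proof.
move=> du dv; have [_ s2 _ _ ex] := csum_exchange (matrix_summable du dv).
have sv k : casum (fun i => row k i * v i) by have /alpha_dualP := dv; apply; exact: row_rapid.
have E k : csum (fun i => u k * (row k i * v i)) = u k * extension v k.
  by rewrite csumZ// /extension pairingC.
have {}E : (fun k => csum (fun i => u k * (row k i * v i))) = (fun k => u k * extension v k).
  exact/funext.
rewrite -E; split; first exact: s2.
rewrite pairingC pairingE -[LHS]/(csum (fun k => u k * extension v k)).
rewrite -E ex pairingE; apply: eq_csum => i.
have [s ->] := coef_pairing i du; rewrite -csumZ//.
by apply: eq_csum => k; rewrite mulrA mulrC.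
Qed.

Lemma extension_sequential : sequential_linear Hdual (rapid M) extension.
Proof.
have sv v k : Hdual v -> casum (fun i => v i * row k i).
  move=> /alpha_dualP /(_ _ (row_rapid k)).
  by under eq_fun do rewrite mulrC.
split.
- move=> v dv; apply: rapid_perfect; apply/alpha_dualP => u du.
  exact: (extension_exchange du dv).1.
- move=> a u v du dv; apply/funext => k; rewrite /extension !pairingE.
  have su := sv _ k du; have sv' := sv _ k dv.
  rewrite -(csumZ a su) -(csumD (casumZ a su) sv').
  by apply: eq_csum => i; rewrite mulrDl mulrA.
- move=> u du; exists (coef (fun x => pairing (f x) u)).
    by apply: alpha_dual_bidual; exact: (HinfE_fun_rapid d_lam (f_HF du)).
  by move=> v dv; exact: (extension_exchange du dv).2.
Qed.

Lemma extension_delta delta : is_delta A mu lam e delta ->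
  forall x, f x = extension (delta x).
Proof.
move=> hd x; apply/funext => k; rewrite /extension pairingC.
by have [_ /(_ _ (f_comp k)) ->] := hd x.
Qed.

End Factorization.

Unset Implicit Arguments.
Set Strict Implicit.
Set Printing Implicit Defensive.

Theorem theorem5p2 (R : realType)
  (X : ptopologicalType) (n : nat) (A : set (chart R X n))
  (mu : {measure set (borel X) -> \bar R})
  (X_compact : compact [set: X]) (X_hausdorff : hausdorff_space X)
  (A_smooth : smooth_atlas A) (mu_density : smooth_positive_density A mu)
  (d : nat -> nat) (lam : nat -> R) (d_lam : spectral_data d lam)
  (e : idx d -> X -> R[i]) (e_basis : orthonormal_basis_L2 mu e)
  (HinfE_smooth : HinfE_eq_smooth A mu lam e)
  (G : completeNormedModType R[i]) (ip : G -> G -> R[i])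
  (ip_hilbert : hilbert_inner_product ip)
  (g : nat -> nat) (nu : nat -> R) (g_nu : spectral_data g nu)
  (h : idx g -> G) (h_basis : orthonormal_basis ip h) :
  let Hseq := HinfE_seq mu lam e in
  let Gseq := GinfF_seq ip nu h in
  (exists! delta : X -> (idx d -> R[i]), is_delta A mu lam e delta) /\
  forall delta : X -> (idx d -> R[i]), is_delta A mu lam e delta ->
    [/\ HinfE_mapping A mu lam e (alpha_dual Hseq) delta,
        forall gt : (idx d -> R[i]) -> (idx g -> R[i]),
          sequential_linear (alpha_dual Hseq) Gseq gt ->
          HinfE_mapping A mu lam e Gseq (fun x => gt (delta x)) &
        forall f : X -> (idx g -> R[i]),
          HinfE_mapping A mu lam e Gseq f ->
          exists fhat : (idx d -> R[i]) -> (idx g -> R[i]),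
            [/\ sequential_linear (alpha_dual Hseq) Gseq fhat,
                forall x, f x = fhat (delta x) &
                forall fhat' : (idx d -> R[i]) -> (idx g -> R[i]),
                  sequential_linear (alpha_dual Hseq) Gseq fhat' ->
                  (forall x, f x = fhat' (delta x)) ->
                  forall v, alpha_dual Hseq v -> fhat' v = fhat v]].
Proof.
move=> Hseq Gseq.
have HE : Hseq = rapid (spec_weight lam) := HinfE_seqE d_lam e_basis.
have GE : Gseq = rapid (spec_weight nu) := GinfF_seqE ip_hilbert g_nu h_basis.
have bid delta a := @bidual_function _ _ _ _ _ A_smooth _ _ _ d_lam e_basis HinfE_smooth delta a.
split.
  exists (smooth_delta A_smooth d_lam e_basis HinfE_smooth).
  split=> [|delta hd]; last exact: (is_delta_unique A_smooth d_lam e_basis HinfE_smooth hd).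
  exact: (smooth_delta_is_delta X_compact A_smooth mu_density d_lam e_basis HinfE_smooth).
move=> delta hd; have hdV x : alpha_dual Hseq (delta x) by case: (hd x).
split.
- by split; [exact: hdV|move=> a da; have [] := bid _ _ hd da].
- move=> gt [gtW _ gtd]; split=> [x|u du]; first exact/gtW/hdV.
  have [a da aE] := gtd u du.
  have -> : (fun x => pairing (gt (delta x)) u) = (fun x => pairing (delta x) a).
    by apply/funext => x; rewrite aE.
  by have [] := bid _ _ hd da.
- move=> f f_map; have f_map' : HinfE_mapping A mu lam e (rapid (spec_weight nu)) f.
    by rewrite -GE.
  have sF : sequential_linear (alpha_dual Hseq) Gseq (extension mu e f).
    rewrite HE GE; exact: (extension_sequential X_compact A_smooth mu_density d_lam e_basis g_nu f_map').
  have dF := extension_delta f_map' hd.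
  exists (extension mu e f); split; [exact: sF|exact: dF|move=> fhat' sF' dF'].
  apply: (sequential_linear_ext A_smooth d_lam e_basis HinfE_smooth hd sF' sF).
  by move=> x; rewrite -dF'.
Qed.
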